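(* Let $r\ge 1$, $m\in\{1,\dots,r\}$ and $n\ge r$ be integers. Let $I,J,K,L\subseteq[r]=\{1,\dots,r\}$ be subsets of cardinality $m$ such that $I\triangle J=K\triangle L$. Let $$\bar I=I\setminus(I\cap J),\quad \bar K=K\setminus(K\cap L),\quad \bar J=J\setminus(I\cap J),\quad \bar L=L\setminus(K\cap L).$$ Assume that the indices in $I$, $J$, $K$ and $L$ are listed according to a total order on $[r]$ under which $$(I\cap J)\setminus(K\cap L)<\bar I<\bar J<(K\cap L)\setminus(I\cap J),\qquad \bar I\cap\bar K<\bar I\cap\bar L,\qquad \bar J\cap\bar K<\bar J\cap\bar L.$$ If $W\sim\mathcal{W}_r(n,I_r)$, then $$\mathrm{E}[\det(W_{I\times J})\det(W_{K\times L})]=\frac{n!}{(n-m)!}\,\frac{(n+2)!}{(n+2-|I\cap J\cap K\cap L|)!}\,\frac{(n-m+|(I\cap J)\setminus(K\cap L)|)!}{(n-m)!}\,|\bar I\cap\bar K|!\,|\bar I\cap\bar L|!.$$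
   Context: The Wishart distribution $\mathcal{W}_r(n,I_r)$ is the law of $XX^T$, where $X\in\mathbb{R}^{r\times n}$ has independent columns each distributed as $\mathcal{N}_r(0,I_r)$, $I_r$ the identity matrix. $I\triangle J=(I\setminus J)\cup(J\setminus I)$ is the symmetric difference. $W_{I\times J}$ is the submatrix of $W$ with row indices in $I$ and column indices in $J$, rows and columns being listed in the order of the index sets given by the chosen total order (the order affects signs of determinants). For a given total order on $[r]$ and $A,B\subseteq[r]$, $A<B$ means that every element of $A$ is smaller than every element of $B$, or that $A$ or $B$ is empty. *)

(* Defs.v *)
From HB Require Import structures.
From mathcomp Require Import all_boot all_order all_algebra.
From mathcomp Require Import all_classical all_reals all_analysis.

Set Implicit Arguments.
Unset Strict Implicit.
Unset Printing Implicit Defensive.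

Import Order.TTheory GRing.Theory Num.Theory.
Import numFieldNormedType.Exports.

Local Open Scope classical_set_scope.
Local Open Scope ring_scope.

(* Matrices carry the sigma-algebra generated by the coordinate maps, as
   [n.-tuple T] does in the library; over [R] it is the Borel sigma-algebra. *)
Definition measure_matrix_display : measure_display -> measure_display.
Proof. exact. Qed.

Section measurable_matrix.
Context {d} {T : measurableType d}.
Variables p q : nat.

Let mx_generators : set (set 'M[T]_(p, q)) :=
  \bigcup_(ij in [set: 'I_p * 'I_q])
    preimage_set_system setT (fun A : 'M[T]_(p, q) => A ij.1 ij.2) measurable.

Let mx_set0 : <<s mx_generators >> set0.
Proof. exact: sigma_algebra0. Qed.

Let mx_setC A : <<s mx_generators >> A -> <<s mx_generators >> (~` A).
Proof. exact: sigma_algebraC. Qed.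

Let mx_bigcup (F : (set 'M[T]_(p, q))^nat) :
  (forall i, <<s mx_generators >> (F i)) -> <<s mx_generators >> (\bigcup_i F i).
Proof. exact: sigma_algebra_bigcup. Qed.

HB.instance Definition _ := @isMeasurable.Build (measure_matrix_display d)
  'M[T]_(p, q) <<s mx_generators >> mx_set0 mx_setC mx_bigcup.

End measurable_matrix.

(* The library has no independence: this is the product rule for a finite
   family of random variables. It covers subfamilies, by taking some of the
   [B i] to be [setT]. *)
Definition independent_family (R : realType) d (Omega : measurableType d)
    (P : probability Omega R) (I : finType) d' (T : measurableType d')
    (X : I -> Omega -> T) : Prop :=
  forall B : I -> set T, (forall i, measurable (B i)) ->
    P [set w | forall i, B i (X i w)] = (\prod_(i : I) P (X i @^-1` B i))%E.

(* [mu] is N_r(0, I_r), the r-fold product of the standard normal law: it is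
   determined by its values on measurable boxes. *)
Definition is_std_normal_vector (R : realType) (r : nat)
    (mu : set 'cV[R]_r -> \bar R) : Prop :=
  forall B : 'I_r -> set R, (forall i, measurable (B i)) ->
    mu [set x | forall i, B i (x i ord0)] =
      (\prod_(i < r) normal_prob 0 1 (B i))%E.

(* [mu] is the Wishart law W_r(n, I_r). *)
Definition is_wishart (R : realType) (r n : nat)
    (mu : set 'M[R]_r -> \bar R) : Prop :=
  exists d (Omega : measurableType d) (P : probability Omega R)
    (X : {RV P >-> 'M[R]_(r, n)}),
    [/\ independent_family P (fun (j : 'I_n) w => col j (X w)),
        forall j : 'I_n,
          is_std_normal_vector (pushforward P (fun w => col j (X w)))
      & forall A : set 'M[R]_r, measurable A ->
          mu A = P [set w | A (X w *m (X w)^T)] ].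

Definition is_total_order (r : nat) (le : rel 'I_r) : Prop :=
  [/\ reflexive le, antisymmetric le, transitive le & total le].

Definition set_lt (r : nat) (le : rel 'I_r) (A B : {set 'I_r}) : Prop :=
  {in A & B, forall a b, (a != b) && le a b}.

Definition symdiff (T : finType) (A B : {set T}) : {set T} :=
  (A :\: B) :|: (B :\: A).

(* The [k]-th element of [A] when [A] is listed in increasing order for [le]. *)
Definition listing (r m : nat) (le : rel 'I_r) (A : {set 'I_r})
    (cardA : #|A| = m) (k : 'I_m) : 'I_r :=
  tnth (sort_tuple le (enum_tuple A)) (cast_ord (esym cardA) k).

(* The submatrix W_{A x B}, rows and columns in increasing order for [le]. *)
Definition submatrix (R : Type) (r m : nat) (le : rel 'I_r) (A B : {set 'I_r})
    (cardA : #|A| = m) (cardB : #|B| = m) (W : 'M[R]_r) : 'M[R]_m :=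
  mxsub (listing le cardA) (listing le cardB) W.

(* Main.v *)
Require Import Defs.
From HB Require Import structures.
From mathcomp Require Import all_boot all_order all_algebra.
From mathcomp Require Import zify ring boolp reals.

Set Implicit Arguments.
Unset Strict Implicit.
Unset Printing Implicit Defensive.

Import Order.TTheory GRing.Theory Num.Theory.

(** Write [W = X X^T], where [X] is an [r x n] matrix of independent standard
normal entries. Both minors are polynomials in the entries of [X], and the
expectation is computed by integrating out one row of [X] after the other.
Each integration replaces the product of minors by a product of smaller ones,
so that only the factors have to be collected. Three kinds of rows occur.

A row [x] used by a single minor, as row and as column: this minor is a
quadratic form [y M y^T] in the row [y], the mean of which is the trace of [M],
namely [n - k] times the minor of size [k] without [x]
([Ex_row_of_one_minor]).

A row [x] in [I] and [K] but in neither [J] nor [L]: both minors are expanded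
along [x] and the two expansions are contracted. For a fixed column [j] of the
first expansion, what remains of the second one is the expansion of the minor
in which row [x] has become row [j]. It vanishes if [j] is in [K]; otherwise
[j] is a row of a single minor and is integrated out in turn
([Ex_row_of_two_minors]).

Once the index sets are reduced to the intersection of all four, the square of
a Gram determinant is left. It is the square of a form [y M y^T] with
[M *m M = D M], [D] being the determinant without that row: [M] is [D] times an
orthogonal projection of rank [n - k]. Its second moment is
[(\tr M)^2 + 2 \tr (M M) = (n - k) (n - k + 2) D^2] ([Ex_square_minor]).

Carried out in the order [(I :&: J) :\: (K :&: L)], [(K :&: L) :\: (I :&: J)],
then the rows shared by [I] and [K], those shared by [I] and [L], and at last
the common ones, these steps produce the factorials
([Ex_product_of_minors]). The total order enters through the signs of the
Laplace expansions only; its hypotheses make the signs met at each step equal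
in pairs ([sg_eq]), so that they cancel.

What the computation needs of the normal law is collected in
[gaussian_functional]: linearity on polynomials, and the second and fourth
moments of a row independent of the other ones. It holds for the mean over [X]
because the entries are independent with moments [0, 1, 3] in degrees [1, 2, 4]
and with all moments finite ([gaussian_functional_mean]). *)

Local Open Scope ring_scope.

(** * Minors on index sets listed along a total order *)

Lemma nth_rem (T : eqType) (x0 x : T) (s : seq T) (k : nat) : x \in s ->
  nth x0 (rem x s) k = nth x0 s (bump (index x s) k).
Proof.
elim: s k => [//|y s IHs] k; rewrite inE /=.
have [-> _|neq_yx /= xs] := eqVneq y x; first by [].
by case: k => [|k] //=; rewrite bumpS /= IHs // -(negPf neq_yx) eq_sym.
Qed.

Section Minors.
Variables (r : nat) (x0 : 'I_r) (le : rel 'I_r).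
Hypothesis le_total : is_total_order le.
Implicit Types A B : {set 'I_r}.

Definition listed (A : {set 'I_r}) : seq 'I_r := sort le (enum A).

(** The number of elements of [A] below [x] is the position of [x] in [listed A];
this is how the signs of cofactors are read off from the sets. *)
Definition below (A : {set 'I_r}) (x : 'I_r) : {set 'I_r} :=
  [set y in A | (y != x) && le y x].

Lemma mem_listed A x : (x \in listed A) = (x \in A).
Proof. by rewrite mem_sort mem_enum. Qed.

Lemma size_listed A : size (listed A) = #|A|.
Proof. by rewrite size_sort -cardE. Qed.

Lemma listed_uniq A : uniq (listed A).
Proof. by rewrite sort_uniq enum_uniq. Qed.

Lemma listed_sorted A : sorted le (listed A).
Proof. by case: le_total => _ _ _ tot; exact: sort_sorted. Qed.

Lemma listedD1 A x : listed (A :\ x) = rem x (listed A).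
Proof.
case: le_total => _ anti trans _.
apply: (sorted_eq trans anti); [exact: listed_sorted| |].
  by apply: (subseq_sorted trans (rem_subseq _ _)); exact: listed_sorted.
apply: uniq_perm; [exact: listed_uniq|exact/rem_uniq/listed_uniq|].
by move=> y; rewrite mem_rem_uniq ?listed_uniq // !inE !mem_listed !inE.
Qed.

Lemma index_listed A x : x \in A -> index x (listed A) = #|below A x|.
Proof.
case: le_total => refl anti trans _ xA.
have [s1 [s2 Es]] : exists s1 s2, listed A = s1 ++ x :: s2.
  by move: xA; rewrite -mem_listed; case/splitPr => s1 s2; exists s1, s2.
have := listed_uniq A; rewrite Es cat_uniq /= => /and4P[us1].
rewrite negb_or => /andP[xs1 _] xs2 us2.
have := listed_sorted A; rewrite (sorted_pairwise trans) Es pairwise_cat /=.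
move=> /and3P[/allrelP s1x _ /andP[/allP xs2le _]].
rewrite index_cat (negPf xs1) /= eqxx addn0 -(card_uniqP us1).
apply: eq_card => y; rewrite !inE -mem_listed Es mem_cat inE.
have [->|neq_yx] := eqVneq y x; first by rewrite (negPf xs1) andbF.
have [ys1|ys1] := boolP (y \in s1) => /=.
  by rewrite s1x // inE eqxx.
have [ys2|//] := boolP (y \in s2).
apply/esym/negP => /= le_yx; case/negP: neq_yx; apply/eqP/anti.
by rewrite le_yx xs2le.
Qed.

Section Laplace.
Variable R : comNzRingType.
Implicit Types W : 'M[R]_r.

(** The determinant is written with size [#|A|] on both sides; it is meant for
sets [A] and [B] of the same cardinality. The default [x0] is then never
reached. *)
Definition minor W (A B : {set 'I_r}) : R :=
  \det (\matrix_(a < #|A|, b < #|A|) W (nth x0 (listed A) a) (nth x0 (listed B) b)).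

Definition sg (A : {set 'I_r}) (x : 'I_r) : R := (-1) ^+ #|below A x|.

Lemma sg_sq A x : sg A x * sg A x = 1.
Proof. by rewrite /sg -expr2 sqrr_sign. Qed.

Lemma big_listed (B : {set 'I_r}) k (F : 'I_r -> R) : #|B| = k ->
  \sum_(j in B) F j = \sum_(b < k) F (nth x0 (listed B) b).
Proof.
move=> <-; rewrite -big_enum /= (perm_big (listed B)) /=; last first.
  by rewrite perm_sym /listed perm_sort.
by rewrite (big_nth x0) big_mkord size_listed.
Qed.

(** Row [(z, x)] of [M *m \adj M = (\det M)%:M], with positions translated into
elements of the sets. The case [z != x] is the expansion of a determinant with
two equal rows; it is what makes most terms vanish later on. *)
Lemma minor_laplace W (A B : {set 'I_r}) x z : #|A| = #|B| ->
  x \in A -> z \in A ->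
  \sum_(j in B) sg A x * sg B j * W z j * minor W (A :\ x) (B :\ j) =
  (z == x)%:R * minor W A B.
Proof.
move=> cAB xA zA.
have cA : #|A| = #|A :\ x|.+1 by rewrite (cardsD1 x) xA.
rewrite (big_listed _ (k := #|A :\ x|.+1)); last by rewrite -cAB.
pose k := #|A :\ x|; pose a y := index y (listed A).
have ltk y : y \in A -> (a y < k.+1)%N.
  by move=> yA; rewrite /k -cA -size_listed index_mem mem_listed.
pose M := \matrix_(a < k.+1, b < k.+1)
  W (nth x0 (listed A) a) (nth x0 (listed B) b).
pose ix := Ordinal (ltk _ xA); pose iz := Ordinal (ltk _ zA).
have -> : minor W A B = \det M by rewrite /minor cA.
have -> : (z == x) = (iz == ix).
  rewrite -[RHS]val_eqE /= /a; apply/eqP/eqP => [->//|].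
  by move/(congr1 (nth x0 (listed A))); rewrite !nth_index ?mem_listed.
have := congr1 (fun N : 'M_k.+1 => N iz ix) (mul_mx_adj M).
rewrite !mxE mulrb mulr_natl mulrb => <-.
apply: eq_bigr => b _.
have bB : nth x0 (listed B) b \in B.
  by rewrite -mem_listed mem_nth // size_listed -cAB cA.
rewrite !mxE nth_index ?mem_listed // [_ * W z _]mulrC -!mulrA mulrA -mulrA.
congr (_ * _); rewrite /cofactor /sg mulrA -exprD -!index_listed //.
rewrite index_uniq ?listed_uniq ?size_listed -?cAB ?cA //.
congr (_ * \det _); apply/matrixP => i j; rewrite !mxE.
rewrite !listedD1 !nth_rem ?mem_listed //.
by rewrite (index_uniq _ _ (listed_uniq B)) // size_listed -cAB cA.
Qed.

Lemma minor_trmx W A B : #|A| = #|B| -> minor W^T A B = minor W B A.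
Proof.
move=> cAB; rewrite /minor cAB -det_tr; congr (\det _).
by apply/matrixP => i j; rewrite !mxE.
Qed.

Lemma minor_laplace_col W A B x z : #|A| = #|B| -> x \in B -> z \in B ->
  \sum_(i in A) sg A i * sg B x * W i z * minor W (A :\ i) (B :\ x) =
  (z == x)%:R * minor W A B.
Proof.
move=> cAB xB zB; rewrite -minor_trmx // -(minor_laplace _ (esym cAB) xB zB).
apply: eq_bigr => i iA; rewrite mxE minor_trmx; last first.
  by apply: succn_inj; move: cAB; rewrite (cardsD1 i) iA (cardsD1 x B) xB.
by rewrite [sg A i * _]mulrC.
Qed.

Lemma sgD1 A x j : j \in A ->
  sg A x = (-1) ^+ ((j != x) && le j x) * sg (A :\ j) x.
Proof.
move=> jA; rewrite /sg (cardsD1 j (below A x)) !inE jA /= exprD.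
congr (_ * (-1) ^+ _); apply: eq_card => y; rewrite !inE.
by case: (y == j) => //=; rewrite andbF.
Qed.

(** Removing [j] changes the position of [x] exactly when [j] comes before [x], and
one of [x] and [j] comes before the other. *)
Lemma sg_swap A x j : x \in A -> j \in A -> j != x ->
  sg A j * sg (A :\ j) x = - (sg A x * sg (A :\ x) j).
Proof.
case: le_total => refl anti trans tot xA jA neq_jx.
rewrite (sgD1 j xA) (sgD1 x jA) [x == j]eq_sym neq_jx /=.
suff -> : (-1) ^+ le x j = - (-1) ^+ le j x :> R by ring.
case/orP: (tot x j) => [xj|jx].
  suff /negPf -> : ~~ le j x by rewrite xj expr1 expr0.
  by apply: contra neq_jx => jx; apply/eqP/anti; rewrite jx xj.
suff /negPf -> : ~~ le x j by rewrite jx expr1 expr0 opprK.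
by apply: contra neq_jx => xj; apply/eqP/anti; rewrite jx xj.
Qed.

(** Double expansion along row [x] and column [x], which isolates the dependence of
the minor on index [x]: it is the formula
[\det (block_mx a u v G) = a * \det G - u *m \adj G *m v] with the entries of the
adjugate written as minors. *)
Lemma minor_bordered W A B x : #|A| = #|B| -> x \in A -> x \in B ->
  minor W A B = sg A x * sg B x * (W x x * minor W (A :\ x) (B :\ x) -
    \sum_(j in B :\ x) \sum_(i in A :\ x) sg (A :\ x) i * sg (B :\ x) j *
      (W x j * W i x) * minor W (A :\ x :\ i) (B :\ x :\ j)).
Proof.
move=> cAB xA xB.
have cABx : #|A :\ x| = #|B :\ x|.
  by apply: succn_inj; move: cAB; rewrite (cardsD1 x) xA (cardsD1 x B) xB.
have := minor_laplace W cAB xA xA; rewrite eqxx mul1r => <-.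
rewrite (bigD1 x) //= mulrBr; congr (_ + _); first by rewrite mulrA.
rewrite mulr_sumr -sumrN; apply: eq_big => [j|j]; first by rewrite !inE andbC.
move=> /andP[jB neq_jx].
have xBj : x \in B :\ j by rewrite !inE eq_sym neq_jx.
have cABj : #|A :\ x| = #|B :\ j|.
  by apply: succn_inj; move: cAB; rewrite (cardsD1 x) xA (cardsD1 j B) jB.
have := minor_laplace_col W cABj xBj xBj; rewrite eqxx mul1r => <-.
rewrite !mulr_sumr -sumrN; apply: eq_bigr => i _.
have -> : B :\ j :\ x = B :\ x :\ j by apply/setP => y; rewrite !inE andbCA.
set D := minor _ _ _; set sA := sg A x; set sAi := sg _ i.
transitivity (sA * sAi * (W x j * W i x) * D * (sg B j * sg (B :\ j) x)).
  by ring.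
by rewrite (sg_swap xB jB neq_jx); ring.
Qed.

Lemma det_submatrix m W (A B : {set 'I_r}) (cA : #|A| = m) (cB : #|B| = m) :
  \det (submatrix le cA cB W) = minor W A B.
Proof.
subst m; rewrite /minor; congr (\det _); apply/matrixP => i j.
by rewrite !mxE /listing !(tnth_nth x0).
Qed.

End Laplace.
End Minors.

(** * Polynomial functions of a matrix and Gaussian functionals *)

Section PolyFun.
Variables (R : realType) (r n : nat).
Local Notation fn := ('M[R]_(r, n) -> R).

(** Polynomials in the entries of the rows satisfying [Q]. A function free of row
[i] is a [polyfun (predC1 i)]. *)
Inductive polyfun (Q : pred 'I_r) : fn -> Prop :=
| polyfun_cst c : polyfun Q (fun=> c)
| polyfun_entry i a : Q i -> polyfun Q (fun X => X i a)
| polyfunD f g : polyfun Q f -> polyfun Q g -> polyfun Q (fun X => f X + g X)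
| polyfunM f g : polyfun Q f -> polyfun Q g -> polyfun Q (fun X => f X * g X).

Lemma polyfunW (Q Q' : pred 'I_r) f : (forall i, Q i -> Q' i) ->
  polyfun Q f -> polyfun Q' f.
Proof.
move=> QQ'; elim=> [c|i a /QQ' Qi|g h _ Pg _ Ph|g h _ Pg _ Ph].
- exact: polyfun_cst.
- exact: polyfun_entry.
- exact: polyfunD.
- exact: polyfunM.
Qed.

Lemma polyfunT (Q : pred 'I_r) f : polyfun Q f -> polyfun predT f.
Proof. exact: polyfunW. Qed.

Variable Q : pred 'I_r.

Lemma polyfun_sum (I : Type) (s : seq I) (P : pred I) (f : I -> fn) :
  (forall k, P k -> polyfun Q (f k)) ->
  polyfun Q (fun X => \sum_(k <- s | P k) f k X).
Proof.
move=> Pf; elim: s => [|k s IHs].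
  by under eq_fun do rewrite big_nil; exact: polyfun_cst.
under eq_fun do rewrite big_cons.
by have [/Pf Pk|//] := boolP (P k); exact: polyfunD.
Qed.

Lemma polyfun_prod (I : Type) (s : seq I) (P : pred I) (f : I -> fn) :
  (forall k, P k -> polyfun Q (f k)) ->
  polyfun Q (fun X => \prod_(k <- s | P k) f k X).
Proof.
move=> Pf; elim: s => [|k s IHs].
  by under eq_fun do rewrite big_nil; exact: polyfun_cst.
under eq_fun do rewrite big_cons.
by have [/Pf Pk|//] := boolP (P k); exact: polyfunM.
Qed.

Lemma polyfunZ c f : polyfun Q f -> polyfun Q (fun X => c * f X).
Proof. exact/polyfunM/polyfun_cst. Qed.

Lemma polyfunN f : polyfun Q f -> polyfun Q (fun X => - f X).
Proof. by move=> Pf; under eq_fun do rewrite -mulN1r; exact: polyfunZ. Qed.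

Lemma polyfun_gram i j : Q i -> Q j ->
  polyfun Q (fun X => (X *m X^T) i j).
Proof.
move=> Qi Qj; under eq_fun do rewrite mxE.
apply: polyfun_sum => a _; under eq_fun do rewrite mxE.
by apply: polyfunM; exact: polyfun_entry.
Qed.

Lemma polyfun_det k (M : 'M[R]_(r, n) -> 'M[R]_k) :
  (forall a b, polyfun Q (fun X => M X a b)) ->
  polyfun Q (fun X => \det (M X)).
Proof.
move=> PM; apply: polyfun_sum => s _; apply: polyfunZ.
by apply: polyfun_prod => a _; exact: PM.
Qed.

Lemma polyfun_minor x0 le (A B : {set 'I_r}) : #|A| = #|B| ->
  {in A, forall i, Q i} -> {in B, forall i, Q i} ->
  polyfun Q (fun X => minor x0 le (X *m X^T) A B).
Proof.
move=> cAB QA QB; apply: polyfun_det => a b; under eq_fun do rewrite mxE.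
apply: polyfun_gram; [apply: QA|apply: QB].
  by rewrite -(mem_listed le) mem_nth // size_listed.
by rewrite -(mem_listed le) mem_nth // size_listed -cAB.
Qed.

End PolyFun.

Section Elimination.
Variables (R : realType) (r n : nat).
Local Notation fn := ('M[R]_(r, n) -> R).

(** The properties of the mean over a standard normal matrix that the computation
of Wishart moments relies on. [Ex4] is Wick's formula for one row. *)
Record gaussian_functional (Ex : fn -> R) : Prop := GaussianFunctional {
  Ex1 : Ex (fun=> 1) = 1;
  ExD : forall f g, polyfun predT f -> polyfun predT g ->
    Ex (fun X => f X + g X) = Ex f + Ex g;
  ExZ : forall c f, polyfun predT f -> Ex (fun X => c * f X) = c * Ex f;
  Ex2 : forall i h a b, polyfun (predC1 i) h ->
    Ex (fun X => h X * (X i a * X i b)) = (a == b)%:R * Ex h;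
  Ex4 : forall i h a b c d, polyfun (predC1 i) h ->
    Ex (fun X => h X * (X i a * X i b * (X i c * X i d))) =
    ((a == b)%:R * (c == d)%:R + (a == c)%:R * (b == d)%:R +
     (a == d)%:R * (b == c)%:R) * Ex h }.

Variables (Ex : fn -> R) (gEx : gaussian_functional Ex).

Lemma Ex_sum (I : Type) (s : seq I) (P : pred I) (f : I -> fn) :
  (forall k, P k -> polyfun predT (f k)) ->
  Ex (fun X => \sum_(k <- s | P k) f k X) = \sum_(k <- s | P k) Ex (f k).
Proof.
move=> Pf; elim: s => [|k s IHs].
  under eq_fun do rewrite big_nil -(mul0r 1).
  by rewrite (ExZ gEx) ?mul0r ?big_nil //; exact: polyfun_cst.
under eq_fun do rewrite big_cons; rewrite big_cons.
have [/Pf Pk|//] := boolP (P k).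
by rewrite (ExD gEx) ?IHs //; exact: polyfun_sum.
Qed.

Lemma Ex_row2 i (f g : 'I_n -> fn) :
  (forall a, polyfun (predC1 i) (f a)) -> (forall a, polyfun (predC1 i) (g a)) ->
  Ex (fun X => (\sum_a X i a * f a X) * (\sum_b X i b * g b X)) =
  Ex (fun X => \sum_a f a X * g a X).
Proof.
move=> Pf Pg.
under eq_fun do rewrite big_distrlr /=.
have PX a : polyfun (n := n) predT (fun X : 'M[R]_(r, n) => X i a).
  exact: polyfun_entry.
have Pf' a := polyfunT (Pf a); have Pg' a := polyfunT (Pg a).
rewrite !Ex_sum => [|a _|a _]; last 2 first.
- exact: polyfunM.
- by apply: polyfun_sum => b _; apply: polyfunM; exact: polyfunM.
apply: eq_bigr => a _; rewrite Ex_sum => [|b _]; last first.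
  by apply: polyfunM; exact: polyfunM.
rewrite (bigD1 a) //= big1 ?addr0 => [|b ba].
  under eq_fun do rewrite mulrACA mulrC.
  rewrite (Ex2 gEx); last exact: polyfunM.
  by rewrite eqxx mul1r.
under eq_fun do rewrite mulrACA mulrC.
rewrite (Ex2 gEx); last exact: polyfunM.
by rewrite eq_sym (negPf ba) mul0r.
Qed.

Lemma Ex_gram_self i h : polyfun (predC1 i) h ->
  Ex (fun X => h X * (X *m X^T) i i) = n%:R * Ex h.
Proof.
move=> Ph.
under eq_fun do rewrite mxE mulr_sumr.
rewrite Ex_sum => [|a _].
  under eq_bigr => a _.
    under eq_fun do rewrite mxE.
    rewrite (Ex2 gEx) // eqxx mul1r.
    over.
  by rewrite sumr_const card_ord mulr_natl.
under eq_fun do rewrite mxE.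
apply: polyfunM; first exact: polyfunT Ph.
by apply: polyfunM; exact: polyfun_entry.
Qed.

Lemma Ex_gram_pair i u v h : polyfun (predC1 i) h -> u != i -> v != i ->
  Ex (fun X => h X * ((X *m X^T) i u * (X *m X^T) i v)) =
  Ex (fun X => h X * (X *m X^T) u v).
Proof.
move=> Ph ui vi; have Pe j a : j != i ->
  polyfun (predC1 i) (fun X : 'M[R]_(r, n) => X j a) by exact: polyfun_entry.
transitivity (Ex (fun X => (\sum_a X i a * (h X * X u a)) *
                           (\sum_b X i b * X v b))).
  congr (Ex _); apply/funext => X; rewrite mulrA !mxE; congr (_ * _).
    by rewrite mulr_sumr; apply: eq_bigr => a _; rewrite !mxE; ring.
  by apply: eq_bigr => a _; rewrite !mxE.
rewrite Ex_row2 => [|a|a]; [|by apply: polyfunM => //; exact: Pe|exact: Pe].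
congr (Ex _); apply/funext => X; rewrite !mxE mulr_sumr.
by apply: eq_bigr => a _; rewrite !mxE mulrA.
Qed.

(** The second moment of a quadratic form [y M y^T]: the three terms are the three
pairings of the four occurrences of the row [y]. *)
Lemma Ex_row4 i (M : 'M[R]_(r, n) -> 'M[R]_n) :
  (forall a b, polyfun (predC1 i) (fun X => M X a b)) ->
  Ex (fun X => (\sum_a \sum_b X i a * X i b * M X a b) ^+ 2) =
  Ex (fun X => (\tr (M X)) ^+ 2 + \tr (M X *m M X) + \tr (M X *m (M X)^T)).
Proof.
move=> PM.
have PX a : polyfun predT (fun X : 'M[R]_(r, n) => X i a).
  exact: polyfun_entry.
have PM' a b := polyfunT (PM a b).
transitivity (\sum_a \sum_b \sum_c \sum_d
  ((a == b)%:R * (c == d)%:R + (a == c)%:R * (b == d)%:R +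
     (a == d)%:R * (b == c)%:R) * Ex (fun X => M X a b * M X c d)).
  have P4 a b c d : polyfun predT
      (fun X => M X a b * M X c d * (X i a * X i b * (X i c * X i d))).
    by repeat apply: polyfunM.
  transitivity (Ex (fun X => \sum_a \sum_b \sum_c \sum_d
      M X a b * M X c d * (X i a * X i b * (X i c * X i d)))).
    congr (Ex _); apply/funext => X; rewrite expr2 mulr_suml.
    apply: eq_bigr => a _; rewrite mulr_suml; apply: eq_bigr => b _.
    rewrite mulr_sumr; apply: eq_bigr => c _; rewrite mulr_sumr.
    by apply: eq_bigr => d _; ring.
  rewrite Ex_sum => [|a _]; last by do 3! apply: polyfun_sum => ? _.
  apply: eq_bigr => a _.
  rewrite Ex_sum => [|b _]; last by do 2! apply: polyfun_sum => ? _.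
  apply: eq_bigr => b _; rewrite Ex_sum => [|c _]; last exact: polyfun_sum.
  apply: eq_bigr => c _; rewrite Ex_sum // ; apply: eq_bigr => d _.
  by rewrite (Ex4 gEx) //; exact: polyfunM.
have P2 a b c d : polyfun predT (fun X => M X a b * M X c d).
  exact: polyfunM.
have sum1 (F : 'I_n -> R) a : \sum_b (a == b)%:R * F b = F a.
  rewrite (bigD1 a) //= eqxx mul1r big1 ?addr0 // => b ba.
  by rewrite eq_sym (negPf ba) mul0r.
pose G a b c d := Ex (fun X => M X a b * M X c d).
transitivity (\sum_a \sum_c G a a c c + \sum_a \sum_b G a b a b +
              \sum_a \sum_b G a b b a).
  rewrite -!big_split; apply: eq_bigr => a _ /=.
  transitivity (\sum_b ((a == b)%:R * (\sum_c G a b c c) + G a b a b + G a b b a)).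
    apply: eq_bigr => b _; rewrite -/(G _ _ _ _).
    transitivity (\sum_c ((a == b)%:R * G a b c c +
        (a == c)%:R * G a b c b + (b == c)%:R * G a b c a)).
      apply: eq_bigr => c _.
      transitivity (\sum_d ((c == d)%:R * ((a == b)%:R * G a b c d) +
          (b == d)%:R * ((a == c)%:R * G a b c d) +
          (a == d)%:R * ((b == c)%:R * G a b c d))).
        by apply: eq_bigr => d _; rewrite /G; ring.
      by rewrite !big_split /= !sum1.
    by rewrite !big_split /= !sum1 mulr_sumr.
  by rewrite !big_split /= sum1.
rewrite /G.
transitivity (Ex (fun X => \sum_a \sum_c M X a a * M X c c +
   \sum_a \sum_b M X a b * M X b a + \sum_a \sum_b M X a b * M X a b)).
  rewrite !(ExD gEx); last 4 first.
  - by do 2! apply: polyfun_sum => ? _.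
  - by do 2! apply: polyfun_sum => ? _.
  - by apply: polyfunD; do 2! apply: polyfun_sum => ? _.
  - by do 2! apply: polyfun_sum => ? _.
  have sum2 (F : 'I_n -> 'I_n -> fn) : (forall a b, polyfun predT (F a b)) ->
      \sum_a \sum_b Ex (F a b) = Ex (fun X => \sum_a \sum_b F a b X).
    move=> PF; rewrite Ex_sum => [|a _]; last exact: polyfun_sum.
    by apply: eq_bigr => a _; rewrite Ex_sum.
  by rewrite addrAC; congr (_ + _ + _); rewrite sum2.
congr (Ex _); apply/funext => X; rewrite /mxtrace; congr (_ + _ + _).
- by rewrite expr2 big_distrlr.
- by apply: eq_bigr => a _; rewrite mxE.
- by apply: eq_bigr => a _; rewrite mxE; apply: eq_bigr => b _; rewrite mxE.
Qed.

End Elimination.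

(** * Integrating out one row *)

Section RowElimination.
Variables (R : realType) (r n : nat) (x0 : 'I_r) (le : rel 'I_r).
Hypothesis le_total : is_total_order le.
Variables (Ex : ('M[R]_(r, n) -> R) -> R) (gEx : gaussian_functional Ex).
Implicit Types (A B C I J K L : {set 'I_r}) (X : 'M[R]_(r, n)).

Local Notation sg := (sg le R).

Definition gram_minor A B X : R := minor x0 le (X *m X^T) A B.

Lemma gram_sym X : (X *m X^T)^T = X *m X^T.
Proof. by rewrite trmx_mul trmxK. Qed.

Lemma gramC X i j : (X *m X^T) i j = (X *m X^T) j i.
Proof. by rewrite -[in LHS]gram_sym mxE. Qed.

Lemma gram_minorC A B X : #|A| = #|B| -> gram_minor A B X = gram_minor B A X.
Proof. by move=> cAB; rewrite /gram_minor -minor_trmx // gram_sym. Qed.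

Lemma cardsD1_eq A B x y : x \in A -> y \in B -> #|A| = #|B| ->
  #|A :\ x| = #|B :\ y|.
Proof.
move=> xA yB cAB; apply: succn_inj; move: cAB.
by rewrite (cardsD1 x) xA (cardsD1 y B) yB.
Qed.

Lemma polyfun_gram_minor (Q : pred 'I_r) A B : #|A| = #|B| ->
  {in A, forall i, Q i} -> {in B, forall i, Q i} -> polyfun Q (gram_minor A B).
Proof. exact: polyfun_minor. Qed.

Lemma polyfun_gram_minorT A B : #|A| = #|B| -> polyfun predT (gram_minor A B).
Proof. by move=> cAB; exact: polyfun_gram_minor. Qed.

Lemma polyfun_gram_minorC1 A B x : #|A| = #|B| -> x \notin A -> x \notin B ->
  polyfun (predC1 x) (gram_minor A B).
Proof.
move=> cAB xA xB; apply: polyfun_gram_minor => // i iAB; apply/eqP => ix.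
  by rewrite ix (negPf xA) in iAB.
by rewrite ix (negPf xB) in iAB.
Qed.

(** By [minor_bordered], the first term contracts to [n] times the smaller minor.
The contraction of each term of the double sum puts [W i j] in the place of
[W x j * W i x], and the sum over [i] is then again the expansion of the smaller
minor, once for each column [j]. *)
Lemma Ex_row_of_one_minor A B x h : #|A| = #|B| -> x \in A -> x \in B ->
  polyfun (predC1 x) h ->
  Ex (fun X => h X * gram_minor A B X) =
  (n%:R - #|A :\ x|%:R) * (sg A x * sg B x) *
    Ex (fun X => h X * gram_minor (A :\ x) (B :\ x) X).
Proof.
move=> cAB xA xB Ph.
have cABx := cardsD1_eq xA xB cAB.
have PhT := polyfunT Ph.
pose D := gram_minor (A :\ x) (B :\ x).
have PD : polyfun (predC1 x) D.
  by apply: polyfun_gram_minorC1; rewrite // !inE eqxx.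
have PDT := polyfunT PD.
pose E i j := gram_minor (A :\ x :\ i) (B :\ x :\ j).
have PE i j : i \in A :\ x -> j \in B :\ x -> polyfun (predC1 x) (E i j).
  move=> iA jB; apply: polyfun_gram_minorC1; first exact: cardsD1_eq.
    by rewrite !inE eqxx andbF.
  by rewrite !inE eqxx andbF.
pose c i j := sg (A :\ x) i * sg (B :\ x) j.
transitivity (Ex (fun X => (sg A x * sg B x) *
   (h X * D X * (X *m X^T) x x + -1 * \sum_(j in B :\ x) \sum_(i in A :\ x)
      c i j * (h X * E i j X * ((X *m X^T) x j * (X *m X^T) x i))))).
  congr (Ex _); apply/funext => X; rewrite /gram_minor.
  rewrite (minor_bordered x0 le_total _ cAB xA xB) mulrCA; congr (_ * _).
  rewrite mulrBr mulN1r; congr (_ - _); first by rewrite /D /gram_minor; ring.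
  rewrite mulr_sumr; apply: eq_bigr => j _; rewrite mulr_sumr.
  apply: eq_bigr => i _; rewrite [(_ *m _) i x]gramC /E /c /gram_minor; ring.
have Pg i j : polyfun predT (fun X => (X *m X^T) i j).
  exact: polyfun_gram.
have Pt i j : i \in A :\ x -> j \in B :\ x -> polyfun predT (fun X =>
    c i j * (h X * E i j X * ((X *m X^T) x j * (X *m X^T) x i))).
  move=> iA jB; apply: polyfunZ; apply: polyfunM; last exact: polyfunM.
  by apply: polyfunM => //; exact: polyfunT (PE _ _ iA jB).
have Pt' i j : i \in A :\ x -> j \in B :\ x -> polyfun predT (fun X =>
    c i j * (h X * E i j X * (X *m X^T) j i)).
  move=> iA jB; apply: polyfunZ; apply: polyfunM => //.
  by apply: polyfunM => //; exact: polyfunT (PE _ _ iA jB).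
have Ps : polyfun predT (fun X => \sum_(j in B :\ x) \sum_(i in A :\ x)
      c i j * (h X * E i j X * ((X *m X^T) x j * (X *m X^T) x i))).
  by apply: polyfun_sum => j jB; apply: polyfun_sum => i iA; exact: Pt.
have PhDx : polyfun predT (fun X => h X * D X * (X *m X^T) x x).
  by apply: polyfunM => //; exact: polyfunM.
rewrite (ExZ gEx) ?(ExD gEx) ?(ExZ gEx) //; last 2 first.
- exact: polyfunZ.
- by apply: polyfunD => //; exact: polyfunZ.
rewrite (Ex_gram_self gEx); last exact: polyfunM.
have -> : Ex (fun X => \sum_(j in B :\ x) \sum_(i in A :\ x)
      c i j * (h X * E i j X * ((X *m X^T) x j * (X *m X^T) x i))) =
    Ex (fun X => #|A :\ x|%:R * (h X * D X)).
  transitivity (Ex (fun X => \sum_(j in B :\ x) \sum_(i in A :\ x)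
      c i j * (h X * E i j X * (X *m X^T) j i))).
    rewrite !(Ex_sum gEx); last 2 first.
    - by move=> j jB; apply: polyfun_sum => i iA; exact: Pt'.
    - by move=> j jB; apply: polyfun_sum => i iA; exact: Pt.
    apply: eq_bigr => j jB.
    rewrite !(Ex_sum gEx); last 2 first.
    - by move=> i iA; exact: Pt'.
    - by move=> i iA; exact: Pt.
    apply: eq_bigr => i iA; rewrite !(ExZ gEx); last 2 first.
    - apply: polyfunM => //; apply: polyfunM => //.
      exact: polyfunT (PE _ _ iA jB).
    - apply: polyfunM; last exact: polyfunM.
      by apply: polyfunM => //; exact: polyfunT (PE _ _ iA jB).
    congr (_ * _); rewrite (Ex_gram_pair gEx) //.
    - by apply: polyfunM => //; exact: PE.
    - by move: jB; rewrite !inE => /andP[].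
    - by move: iA; rewrite !inE => /andP[].
  congr (Ex _); apply/funext => X.
  rewrite cABx -sum1_card natr_sum mulr_suml; apply: eq_bigr => j jB.
  have := minor_laplace_col x0 le_total (X *m X^T) cABx jB jB.
  rewrite eqxx !mul1r /D /gram_minor => <-; rewrite mulr_sumr.
  by apply: eq_bigr => i _; rewrite [(_ *m _) j i]gramC /c /E /gram_minor; ring.
rewrite (ExZ gEx); last exact: polyfunM.
by ring.
Qed.

(** Contracting the two expansions along row [x] gives, for each column [j] of the
first one, the expansion of the second minor with row [x] replaced by [j]. This
is zero for [j] in [K], and otherwise row [j] occurs in that minor only. *)
Lemma Ex_row_of_two_minors I J K L x : #|I| = #|J| -> #|K| = #|L| ->
  x \in I -> x \in K -> x \notin J -> x \notin L ->
  J :\: K \subset L :\: I ->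
  Ex (fun X => gram_minor I J X * gram_minor K L X) =
  (n%:R - #|K :\ x|%:R) * \sum_(j in J :\: K)
    (sg I x * sg K x) * (sg J j * sg L j) *
    Ex (fun X => gram_minor (I :\ x) (J :\ j) X * gram_minor (K :\ x) (L :\ j) X).
Proof.
move=> cIJ cKL xI xK xJ xL sJK.
pose E j := gram_minor (I :\ x) (J :\ j).
pose F l := gram_minor (K :\ x) (L :\ l).
have neqx (B : {set 'I_r}) j : x \notin B -> j \in B -> j != x.
  by move=> xB jB; apply: contraNneq xB => <-.
have PE j : j \in J -> polyfun (predC1 x) (E j).
  move=> jJ; apply: polyfun_gram_minorC1; first exact: cardsD1_eq.
    by rewrite !inE eqxx.
  by rewrite !inE negb_and xJ orbT.
have PF l : l \in L -> polyfun (predC1 x) (F l).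
  move=> lL; apply: polyfun_gram_minorC1; first exact: cardsD1_eq.
    by rewrite !inE eqxx.
  by rewrite !inE negb_and xL orbT.
have Pg i j : polyfun predT (fun X => (X *m X^T) i j).
  exact: polyfun_gram.
pose c j l := sg I x * sg J j * (sg K x * sg L l).
transitivity (Ex (fun X => \sum_(j in J) \sum_(l in L)
    c j l * (E j X * F l X * ((X *m X^T) x j * (X *m X^T) x l)))).
  congr (Ex _); apply/funext => X; rewrite /gram_minor.
  have := minor_laplace x0 le_total (X *m X^T) cIJ xI xI.
  rewrite eqxx mul1r => <-.
  have := minor_laplace x0 le_total (X *m X^T) cKL xK xK.
  rewrite eqxx mul1r => <-.
  rewrite big_distrlr /=; apply: eq_bigr => j _; apply: eq_bigr => l _.
  by rewrite /c /E /F /gram_minor; ring.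
transitivity (Ex (fun X => \sum_(j in J) \sum_(l in L)
    c j l * (E j X * F l X * (X *m X^T) j l))).
  have P1 j l : j \in J -> l \in L -> polyfun predT
      (fun X => E j X * F l X * ((X *m X^T) x j * (X *m X^T) x l)).
    move=> jJ lL; apply: polyfunM; last exact: polyfunM.
    by apply: polyfunM; [exact: polyfunT (PE _ jJ)|exact: polyfunT (PF _ lL)].
  have P2 j l : j \in J -> l \in L -> polyfun predT
      (fun X => E j X * F l X * (X *m X^T) j l).
    move=> jJ lL; apply: polyfunM => //.
    by apply: polyfunM; [exact: polyfunT (PE _ jJ)|exact: polyfunT (PF _ lL)].
  rewrite !(Ex_sum gEx); last 2 first.
  - move=> j jJ; apply: polyfun_sum => l lL; apply: polyfunZ; exact: P2.
  - move=> j jJ; apply: polyfun_sum => l lL; apply: polyfunZ; exact: P1.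
  apply: eq_bigr => j jJ; rewrite !(Ex_sum gEx); last 2 first.
  - by move=> l lL; apply: polyfunZ; exact: P2.
  - by move=> l lL; apply: polyfunZ; exact: P1.
  apply: eq_bigr => l lL; rewrite !(ExZ gEx); [|exact: P2|exact: P1].
  congr (_ * _); rewrite (Ex_gram_pair gEx) //; last 2 first.
  - exact: neqx jJ.
  - exact: neqx lL.
  by apply: polyfunM; [exact: PE|exact: PF].
(* The row set of the second minor after row [x] has become row [j]. *)
pose K' j := j |: (K :\ x).
have cK' j : j \notin K -> #|K' j| = #|K|.
  by move=> jK; rewrite cardsU1 !inE (negPf jK) andbF [RHS](cardsD1 x) xK.
transitivity (Ex (fun X => \sum_(j in J :\: K)
   sg I x * sg J j * sg K x * sg (K' j) j * (E j X * gram_minor (K' j) L X))).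
  congr (Ex _); apply/funext => X.
  rewrite (bigID (fun j => j \in K)) /= big1 ?add0r => [|j /andP[jJ jK]].
    apply: eq_big => [j|j /andP[jJ jK]]; first by rewrite !inE andbC.
    have cKL' : #|K' j| = #|L| by rewrite cK'.
    have jK' : j \in K' j by rewrite !inE eqxx.
    have K'D1 : K' j :\ j = K :\ x.
      apply/setP => y; rewrite !inE.
      by have [->|//] := eqVneq y j; rewrite (negPf jK) andbF.
    have := minor_laplace x0 le_total (X *m X^T) cKL' jK' jK'.
    rewrite eqxx mul1r K'D1 /gram_minor => <-; rewrite !mulr_sumr.
    apply: eq_bigr => l _; rewrite /c /F /gram_minor.
    transitivity (sg I x * sg J j * sg K x *
      (sg (K' j) j * sg (K' j) j) * sg L l * (E j X) * (X *m X^T) j l *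
      minor x0 le (X *m X^T) (K :\ x) (L :\ l)); last by ring.
    by rewrite sg_sq; ring.
  have := minor_laplace x0 le_total (X *m X^T) cKL xK jK.
  rewrite (negPf (neqx _ _ xJ jJ)) mul0r => E0.
  rewrite -[RHS](mulr0 (sg I x * sg J j * E j X)) -[X in _ = _ * X]E0 mulr_sumr.
  by apply: eq_bigr => l _; rewrite /c /F /gram_minor; ring.
have inJ j : j \in J :\: K -> [/\ j \in J, j \notin K, j \in L & j \notin I].
  by move=> jJK; have := subsetP sJK _ jJK; move: jJK; rewrite !inE =>
    /andP[-> ->] /andP[-> ->].
have P1 j : j \in J :\: K ->
    polyfun predT (fun X => E j X * gram_minor (K' j) L X).
  move=> /inJ[jJ jK jL jI]; apply: polyfunM; first exact: polyfunT (PE _ jJ).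
  by apply: polyfun_gram_minorT; rewrite cK'.
rewrite (Ex_sum gEx) => [|j jJK]; last exact/polyfunZ/P1.
rewrite mulr_sumr; apply: eq_bigr => j jJK; rewrite (ExZ gEx); last exact: P1.
have [jJ jK jL jI] := inJ _ jJK.
have jK' : j \in K' j by rewrite !inE eqxx.
have K'D1 : K' j :\ j = K :\ x.
  apply/setP => y; rewrite !inE.
  by have [->|//] := eqVneq y j; rewrite (negPf jK) andbF.
rewrite (@Ex_row_of_one_minor (K' j) L j) ?cK' //; last first.
  apply: polyfun_gram_minorC1; first exact: cardsD1_eq.
    by rewrite !inE (negPf jI) andbF.
  by rewrite !inE eqxx.
rewrite K'D1.
set EE := Ex _; transitivity (sg I x * sg J j * sg K x *
  (sg (K' j) j * sg (K' j) j) * (n%:R - #|K :\ x|%:R) * sg L j * EE); first by ring.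
by rewrite sg_sq; ring.
Qed.

(** As a function of row [x], the minor is [y M y^T] with [M = D - X^T adj X], where
[D] is the minor without [x] and [adj] the adjugate of its matrix. From
[adj W adj = D adj] one gets [M M = D M] and [\tr M = (n - k) D], and [M] is
symmetric; it remains to apply [Ex_row4]. *)
Lemma Ex_square_minor C x : x \in C ->
  Ex (fun X => gram_minor C C X * gram_minor C C X) =
  (n%:R - #|C :\ x|%:R) * (n%:R + 2 - #|C :\ x|%:R) *
  Ex (fun X => gram_minor (C :\ x) (C :\ x) X * gram_minor (C :\ x) (C :\ x) X).
Proof.
move=> xC; set C' := C :\ x; set k := #|C'|.
(* The adjugate of the submatrix on [C'], extended by 0 to all indices. *)
pose adj X : 'M[R]_r := \matrix_(i, j)
  if (i \in C') && (j \in C') then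
    sg C' i * sg C' j * gram_minor (C' :\ i) (C' :\ j) X else 0.
pose D := gram_minor C' C'.
pose M X := (D X)%:M - X^T *m adj X *m X.
(* Cramer's rule on [C']. *)
have adjW X i j : j \in C' -> (adj X *m (X *m X^T)) i j =
    ((i == j) && (i \in C'))%:R * D X.
  move=> jC'; rewrite mxE.
  have [iC'|iC'] := boolP (i \in C'); last first.
    rewrite andbF mul0r big1 // => l _.
    by rewrite mxE (negPf iC') mul0r.
  rewrite andbT (bigID (fun l => l \in C')) /= addrC big1 ?add0r; last first.
    by move=> l /negPf lC'; rewrite mxE lC' andbF mul0r.
  have := minor_laplace x0 le_total (X *m X^T) (erefl #|C'|) iC' jC'.
  rewrite eq_sym => <-; apply: eq_bigr => l lC'.
  by rewrite mxE iC' lC' /= [in LHS]gramC /gram_minor; ring.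
have adj_idem X : adj X *m (X *m X^T) *m adj X = D X *: adj X.
  apply/matrixP => i k'; rewrite mxE (bigID (fun l => l \in C')) /= addrC.
  rewrite big1 ?add0r => [|l /negPf lC']; last by rewrite [adj X l k']mxE lC' mulr0.
  under eq_bigr => l lC' do rewrite adjW //.
  rewrite [RHS]mxE; have [iC'|iC'] := boolP (i \in C'); last first.
    rewrite big1 ?[adj X _ _]mxE ?(negPf iC') ?mulr0 // => l _.
    by rewrite andbF !mul0r.
  rewrite (bigD1 i) //= eqxx mul1r big1 ?addr0 // => l /andP[_ li].
  by rewrite eq_sym (negPf li) !mul0r.
have tr_adj X : \tr (X^T *m adj X *m X) = k%:R * D X.
  rewrite mxtrace_mulC mulmxA mxtrace_mulC /mxtrace.
  rewrite (bigID (fun l => l \in C')) /= addrC big1 ?add0r; last first.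
    move=> i /negPf iC'; rewrite mxE big1 // => l _.
    by rewrite mxE iC' mul0r.
  under eq_bigr => l lC' do rewrite adjW // eqxx lC' mul1r.
  by rewrite sumr_const mulr_natl.
have adj_sym X : (adj X)^T = adj X.
  apply/matrixP => i j; rewrite !mxE andbC.
  case: ifP => // /andP[iC' jC'].
  by rewrite gram_minorC 1?[sg _ j * _]mulrC //; exact: cardsD1_eq.
have trM X : \tr (M X) = (n%:R - k%:R) * D X.
  by rewrite /M linearB /= mxtrace_scalar tr_adj -[D X *+ _]mulr_natl -mulrBl.
have MM X : M X *m M X = D X *: M X.
  rewrite {1}/M mulmxBl mul_scalar_mx; set T := X^T *m _ *m _.
  have TT : T *m T = D X *: T.
    transitivity (X^T *m (adj X *m (X *m X^T) *m adj X) *m X).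
      by rewrite /T !mulmxA.
    by rewrite adj_idem -scalemxAr -scalemxAl.
  by rewrite /M mulmxBr TT mul_mx_scalar subrr subr0.
have Mt X : (M X)^T = M X.
  by rewrite /M linearB /= tr_scalar_mx !trmx_mul trmxK adj_sym mulmxA.
have minorM X : gram_minor C C X = \sum_a \sum_b X x a * X x b * M X a b.
  rewrite /gram_minor (minor_bordered x0 le_total _ (erefl #|C|) xC xC).
  rewrite sg_sq mul1r -/C'.
  transitivity ((row x X *m M X *m (row x X)^T) 0 0); last first.
    rewrite mxE exchange_big; apply: eq_bigr => b _; rewrite !mxE mulr_suml.
    by apply: eq_bigr => a _; rewrite !mxE; ring.
  have mx1B (A B : 'M[R]_1) : (A - B) 0 0 = A 0 0 - B 0 0 by rewrite !mxE.
  rewrite /M mulmxBr mulmxBl mul_mx_scalar -scalemxAl mx1B [X in _ = X - _]mxE.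
  congr (_ - _).
    rewrite mulrC /D; congr (_ * _); rewrite !mxE.
    by apply: eq_bigr => a _; rewrite !mxE.
  have -> : row x X *m (X^T *m adj X *m X) *m (row x X)^T =
     row x (X *m X^T) *m adj X *m (row x (X *m X^T))^T.
    rewrite !row_mul !trmx_mul trmxK !mulmxA.
    by [].
  rewrite [RHS]mxE [RHS](bigID (fun l => l \in C')) /= [RHS]addrC.
  rewrite [X in _ = X + _]big1 ?add0r; last first.
    move=> i /negPf iC'; rewrite mxE big1 ?mul0r // => l _.
    by rewrite [adj X _ _]mxE iC' andbF mulr0.
  apply: eq_bigr => j jC'; rewrite [X in _ = X * _]mxE.
  rewrite [X in _ = X * _](bigID (fun l => l \in C')) /=.
  rewrite [X in _ = (_ + X) * _]big1 ?addr0; last first.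
    by move=> i /negPf iC'; rewrite [adj X _ _]mxE iC' mulr0.
  rewrite mulr_suml; apply: eq_bigr => i iC'.
  rewrite [adj X _ _]mxE iC' jC' !mxE -/(gram_minor _ _ _).
  rewrite [\sum_j X i j * _](_ : _ = (X *m X^T) x i); last by rewrite gramC !mxE.
  rewrite !mxE. by rewrite /=; ring.
transitivity (Ex (fun X => (\sum_a \sum_b X x a * X x b * M X a b) ^+ 2)).
  by congr (Ex _); apply/funext => X; rewrite -minorM expr2.
have PD : polyfun (predC1 x) D.
  by apply: polyfun_gram_minorC1; rewrite // !inE eqxx.
rewrite (Ex_row4 gEx) => [|a b]; last first.
  rewrite /M; under eq_fun do rewrite !mxE.
  apply: polyfunD.
    under eq_fun do rewrite -mulr_natl; exact: polyfunZ.
  apply: polyfunN; apply: polyfun_sum => j _; under eq_fun do rewrite !mxE.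
  have [jC'|/negPf jC'] := boolP (j \in C'); last first.
    have -> : (fun X => (\sum_i X^T a i * adj X i j) * X j b) = (fun=> 0).
      apply/funext => X; rewrite big1 ?mul0r // => i _.
      by rewrite [adj X _ _]mxE jC' andbF mulr0.
    exact: polyfun_cst.
  have neqx i : i \in C' -> i != x by rewrite !inE => /andP[].
  apply: polyfunM; last by apply: polyfun_entry; exact: neqx.
  apply: polyfun_sum => i _; under eq_fun do rewrite !mxE.
  have [iC'|/negPf iC'] := boolP (i \in C'); last first.
    by under eq_fun do rewrite mulr0; exact: polyfun_cst.
  rewrite jC' /=; apply: polyfunM; first by apply: polyfun_entry; exact: neqx.
  apply: polyfunZ; apply: polyfun_gram_minorC1; first exact: cardsD1_eq.
    by rewrite !inE eqxx andbF.
  by rewrite !inE eqxx andbF.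
rewrite -(ExZ gEx); last by apply: polyfunM; exact: polyfunT PD.
congr (Ex _); apply/funext => X; rewrite Mt MM linearZ /= trM -/(D X).
ring.
Qed.

End RowElimination.

(** * Removing whole index sets *)

Ltac nat_lia := repeat match goal with
  | H : ?T |- _ => lazymatch T with
    | @eq nat _ _ => fail | is_true (leq _ _) => fail | _ => clear H end
  end; lia.

(** Solves for [e0] the triangular system of relations between the expectations met
after each removal. *)
Lemma eliminate_chain (F : fieldType) (u v w x y p q N N2 e0 e1 e2 e3 e4 : F) :
  u != 0 -> v != 0 -> w != 0 -> x != 0 -> y != 0 ->
  u * e0 = v * e1 -> u * e1 = v * e2 -> v * e2 = p * w * e3 ->
  w * e3 = q * x * e4 -> x * y * e4 = N * N2 ->
  e0 = N / u * (N2 / y) * (v / u) * p * q.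
Proof.
move=> u0 v0 w0 x0 y0 E0 E1 E2 E3 E4.
apply: (mulfI (mulf_neq0 u0 u0)); transitivity (v * p * (q * x * e4)).
  by rewrite -E3 -mulrA E0 mulrCA E1 E2; ring.
transitivity (N * N2 * (v * p * q) / y); last by field; rewrite u0.
by rewrite -E4; field.
Qed.

Section Recursion.
Variables (R : realType) (r n : nat) (x0 : 'I_r) (le : rel 'I_r).
Hypothesis le_total : is_total_order le.
Variables (Ex : ('M[R]_(r, n) -> R) -> R) (gEx : gaussian_functional Ex).
Implicit Types (A B C I J K L S T : {set 'I_r}) (X : 'M[R]_(r, n)).

Local Notation sg := (sg le R).
Local Notation D := (gram_minor x0 le).

(** Elements common to [A] and [B] shift the position of [x] equally in both. *)
Lemma sg_eq A B x : #|below le (A :\: B) x| = #|below le (B :\: A) x| ->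
  sg A x = sg B x.
Proof.
move=> eqAB; rewrite /sg -(cardsID B (below le A x)) -(cardsID A (below le B x)).
congr (_ ^+ (_ + _)).
  by apply: eq_card => y; rewrite !inE andbAC [RHS]andbAC andbC [RHS]andbC
    [X in _ && X]andbC.
have -> : below le A x :\: B = below le (A :\: B) x.
  by apply/setP => y; rewrite !inE andbA.
have -> : below le B x :\: A = below le (B :\: A) x.
  by apply/setP => y; rewrite !inE andbA.
exact: eqAB.
Qed.

(** Iterates [Ex_row_of_one_minor] over [T]. The condition on positions involves
only [I :\: J] and [J :\: I], which are unchanged when an element of [T] is
removed, so it survives the induction. Factorials stand for the product of the
successive factors [n - k]. *)
Lemma Ex_strip_common_rows T I J h : T \subset I :&: J -> #|I| = #|J| -> (#|I| <= n)%N ->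
  {in T, forall t, polyfun (predC1 t) h} ->
  {in T, forall t, #|below le (I :\: J) t| = #|below le (J :\: I) t|} ->
  (n - #|I|)`!%:R * Ex (fun X => h X * D I J X) =
  (n - #|I| + #|T|)`!%:R * Ex (fun X => h X * D (I :\: T) (J :\: T) X).
Proof.
have [a] := ubnP #|T|; elim: a => // a IHa in T I J *.
case: (set_0Vmem T) => [-> _ _ _ _ _ _|[t tT]]; first by rewrite cards0 addn0 !setD0.
move=> leTa sT cIJ In PT signT.
have /andP[tI tJ] : (t \in I) && (t \in J) by rewrite -in_setI (subsetP sT).
rewrite (@Ex_row_of_one_minor _ _ _ _ _ le_total _ gEx _ _ t) //; last exact: PT.
have -> : sg J t = sg I t by apply/esym/sg_eq/signT.
rewrite sg_sq mulr1 mulrA -natrB; last first.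
  by apply: leq_trans (subset_leq_card (subsetDl _ _)) In.
have cI := cardsD1 t I; rewrite tI in cI.
have cT := cardsD1 t T; rewrite tT in cT.
rewrite -natrM; have -> : ((n - #|I|)`! * (n - #|I :\ t|) = (n - #|I :\ t|)`!)%N.
  have -> : (n - #|I :\ t| = (n - #|I|).+1)%N by nat_lia.
  by rewrite factS mulnC.
rewrite (IHa (T :\ t)); first last.
- move=> s; rewrite !inE => /andP[st sT'].
  have -> : (I :\ t) :\: (J :\ t) = I :\: J.
    by apply/setP => y; rewrite !inE; case: (eqVneq y t) => // ->; rewrite tI tJ.
  have -> : (J :\ t) :\: (I :\ t) = J :\: I.
    by apply/setP => y; rewrite !inE; case: (eqVneq y t) => // ->; rewrite tI tJ.
  exact: signT.
- by move=> s; rewrite !inE => /andP[_]; exact: PT.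
- nat_lia.
- exact: cardsD1_eq.
- apply/subsetP => y; rewrite !inE => /andP[-> yT] /=.
  by have := subsetP sT _ yT; rewrite inE.
- nat_lia.
have -> : (n - #|I :\ t| + #|T :\ t| = n - #|I| + #|T|)%N by nat_lia.
have sub1 A : (A :\ t) :\: (T :\ t) = A :\: T.
  by apply/setP => y; rewrite !inE; case: (eqVneq y t) => // ->; rewrite tT.
by rewrite !sub1.
Qed.

(** Iterates [Ex_row_of_two_minors]. Each step has one term for each remaining
element of [T], all of the same value by induction, whence [#|S|`!]. *)
Lemma Ex_strip_paired_rows S T I J K L : #|I| = #|J| -> #|K| = #|L| -> #|I| = #|K| ->
  (#|I| <= n)%N -> #|S| = #|T| ->
  S \subset I :&: K -> [disjoint S & J] -> [disjoint S & L] ->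
  T = J :\: K -> T \subset L :\: I ->
  {in S, forall x, #|below le (I :\: K) x| = #|below le (K :\: I) x|} ->
  {in T, forall j, #|below le (J :\: L) j| = #|below le (L :\: J) j|} ->
  (n - #|I|)`!%:R * Ex (fun X => D I J X * D K L X) =
  #|S|`!%:R * (n - #|I| + #|S|)`!%:R *
  Ex (fun X => D (I :\: S) (J :\: T) X * D (K :\: S) (L :\: T) X).
Proof.
have [a] := ubnP #|S|; elim: a => // a IHa in S T I J K L *.
case: (set_0Vmem S) => [->|[x xS]].
  rewrite cards0 => _ _ _ _ _ /esym/eqP; rewrite cards_eq0 => /eqP ->.
  by rewrite addn0 fact0 mul1r !setD0.
move=> leSa cIJ cKL cIK In cST sS SJ SL defT sT signS signT.
have /andP[xI xK] : (x \in I) && (x \in K) by rewrite -in_setI (subsetP sS).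
have xJ : x \notin J by rewrite (disjointFr SJ xS).
have xL : x \notin L by rewrite (disjointFr SL xS).
have inT j : j \in T -> [/\ j \in J, j \notin K, j \in L & j \notin I].
  move=> jT; have := subsetP sT _ jT; rewrite !inE => /andP[-> ->].
  by move: jT; rewrite defT !inE => /andP[-> ->].
rewrite (@Ex_row_of_two_minors _ _ _ _ _ le_total _ gEx _ _ _ _ x) // -?defT //.
have cI := cardsD1 x I; rewrite xI in cI.
have cK := cardsD1 x K; rewrite xK in cK.
have cS := cardsD1 x S; rewrite xS in cS.
rewrite mulrA -natrB; last by nat_lia.
rewrite -[X in X * \sum_(_ in _) _]natrM.
have -> : ((n - #|I|)`! * (n - #|K :\ x|) = (n - #|I :\ x|)`!)%N.
  have -> : (n - #|K :\ x| = (n - #|I|).+1)%N by nat_lia.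
  have -> : (n - #|I :\ x| = (n - #|I|).+1)%N by nat_lia.
  by rewrite factS mulnC.
have sub1 A : (A :\ x) :\: (S :\ x) = A :\: S.
  by apply/setP => y; rewrite !inE; case: (eqVneq y x) => // ->; rewrite xS.
set E := Ex (fun X => D (I :\: S) _ X * _).
rewrite mulr_sumr.
transitivity (\sum_(j in T)
   (#|S :\ x|`!%:R * (n - #|I| + #|S|)`!%:R * E)); last first.
  have factS' : #|S|`! = (#|S| * #|S :\ x|`!)%N by rewrite cS factS.
  by rewrite sumr_const -cST -[LHS]mulr_natl factS' natrM !mulrA.
apply: eq_bigr => j jT; have [jJ jK jL jI] := inT _ jT.
have -> : sg K x = sg I x by apply/esym/sg_eq/signS.
have -> : sg L j = sg J j by apply/esym/sg_eq/signT.
rewrite !sg_sq !mul1r.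
have cJ := cardsD1 j J; rewrite jJ in cJ.
have cL := cardsD1 j L; rewrite jL in cL.
have cT := cardsD1 j T; rewrite jT in cT.
rewrite (IHa (S :\ x) (T :\ j)); first last.
- move=> t; rewrite !inE => /andP[tj tT].
  have -> : (J :\ j) :\: (L :\ j) = J :\: L.
    by apply/setP => y; rewrite !inE; case: (eqVneq y j) => // ->; rewrite jJ jL.
  have -> : (L :\ j) :\: (J :\ j) = L :\: J.
    by apply/setP => y; rewrite !inE; case: (eqVneq y j) => // ->; rewrite jJ jL.
  exact: signT.
- move=> t; rewrite !inE => /andP[tx tS].
  have -> : (I :\ x) :\: (K :\ x) = I :\: K.
    by apply/setP => y; rewrite !inE; case: (eqVneq y x) => // ->; rewrite xI xK.
  have -> : (K :\ x) :\: (I :\ x) = K :\: I.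
    by apply/setP => y; rewrite !inE; case: (eqVneq y x) => // ->; rewrite xI xK.
  exact: signS.
- apply/subsetP => y; rewrite !inE => /andP[-> /inT[_ _ -> /negPf ->]].
  by rewrite andbF.
- apply/setP => y; rewrite defT !inE; case: (eqVneq y x) => [->|_] /=.
    by rewrite (negPf xJ) !andbF.
  by rewrite andbCA.
- rewrite disjoint_subset; apply/subsetP => y; rewrite !inE => /andP[_ yS].
  by rewrite negb_and (disjointFr SL yS) orbT.
- rewrite disjoint_subset; apply/subsetP => y; rewrite !inE => /andP[_ yS].
  by rewrite negb_and (disjointFr SJ yS) orbT.
- apply/subsetP => y; rewrite !inE => /andP[-> yS] /=.
  by have := subsetP sS _ yS; rewrite inE.
- nat_lia.
- nat_lia.
- nat_lia.
- nat_lia.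
- nat_lia.
- nat_lia.
have sub2 A : (A :\ j) :\: (T :\ j) = A :\: T.
  by apply/setP => y; rewrite !inE; case: (eqVneq y j) => // ->; rewrite jT.
rewrite !sub1 !sub2 /E; congr (_ * _`!%:R * _); nat_lia.
Qed.

Lemma Ex_minor_square C : (#|C| <= n)%N ->
  (n - #|C|)`!%:R * (n + 2 - #|C|)`!%:R * Ex (fun X => D C C X * D C C X) =
  n`!%:R * (n + 2)`!%:R.
Proof.
have [a] := ubnP #|C|; elim: a => // a IHa in C *.
case: (set_0Vmem C) => [-> _ _|[x xC]].
  rewrite cards0 !subn0 -[RHS]mulr1; congr (_ * _).
  rewrite -(Ex1 gEx); congr (Ex _); apply/funext => X.
  by rewrite /gram_minor /minor; move: (\matrix_(_, _) _); rewrite cards0 => M;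
    rewrite det_mx00 mulr1.
move=> leCa Cn; rewrite (@Ex_square_minor _ _ _ _ _ le_total _ gEx _ x) //.
have cC := cardsD1 x C; rewrite xC in cC.
rewrite -(IHa (C :\ x)) -?natrB; [|nat_lia..].
rewrite -(natrD _ n 2) -natrB; last by nat_lia.
rewrite mulrA; congr (_ * _); rewrite -!natrM; congr (_%:R).
have -> : (n - #|C :\ x| = (n - #|C|).+1)%N by nat_lia.
have -> : (n + 2 - #|C :\ x| = (n + 2 - #|C|).+1)%N by nat_lia.
by rewrite !factS; nat_lia.
Qed.

Section Expectation.
Variables (m : nat) (I J K L : {set 'I_r}).
Hypotheses (cardI : #|I| = m) (cardJ : #|J| = m) (cardK : #|K| = m)
  (cardL : #|L| = m) (m_le_n : (m <= n)%N)
  (symdiffE : symdiff I J = symdiff K L).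
Let bI := I :\: (I :&: J).
Let bK := K :\: (K :&: L).
Let bJ := J :\: (I :&: J).
Let bL := L :\: (K :&: L).
Hypotheses (ltA : set_lt le ((I :&: J) :\: (K :&: L)) bI)
  (ltIJ : set_lt le bI bJ)
  (ltD : set_lt le bJ ((K :&: L) :\: (I :&: J)))
  (ltI : set_lt le (bI :&: bK) (bI :&: bL))
  (ltJ : set_lt le (bJ :&: bK) (bJ :&: bL)).

Let A := (I :&: J) :\: (K :&: L).
Let A' := (K :&: L) :\: (I :&: J).
Let S1 := bI :&: bK.
Let S2 := bI :&: bL.
Let S3 := bJ :&: bK.
Let S4 := bJ :&: bL.
Let C := I :&: J :&: K :&: L.

Let symP y : (y \in I) (+) (y \in J) = (y \in K) (+) (y \in L).
Proof.
have /setP/(_ y) := symdiffE; rewrite !inE.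
by do 4! case: (y \in _).
Qed.

Ltac set_cases :=
  let y := fresh "y" in apply/setP => y; have := symP y; rewrite !inE;
  do 4! case: (y \in _).

(** The rows are removed in the order [A], [A'], [S1] with [S4], [S2] with [S3], and
last [C]. After [S1] and [S4] are gone, [K] has become [J] and [L] has become
[I]; as [W] is symmetric the second minor may be transposed, and the
same elimination applies to [S2] and [S3]. *)
Lemma Ex_product_of_minors :
  Ex (fun X => D I J X * D K L X) =
  n`!%:R / (n - m)`!%:R * ((n + 2)`!%:R / (n + 2 - #|C|)`!%:R) *
  ((n - m + #|A|)`!%:R / (n - m)`!%:R) * #|S1|`!%:R * #|S2|`!%:R.
Proof.
(* Counting: the four index sets have the same size [m]. *)
have cA : #|A| = #|A'| /\ #|S2| = #|S3| /\ #|S1| = #|S4| /\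
    m = (#|A| + #|S1| + #|S2| + #|C|)%N.
  have c2 (B B1 B2 : {set 'I_r}) : B1 = B :&: B1 -> B2 = B :\: B1 ->
      #|B| = (#|B1| + #|B2|)%N by move=> e1 e2; rewrite -(cardsID B1 B) -e1 -e2.
  have e1 : #|I| = (#|A| + #|I :\: A|)%N by apply: c2 => //; set_cases.
  have e2 : #|J| = (#|A| + #|J :\: A|)%N by apply: c2 => //; set_cases.
  have e3 : #|K| = (#|A'| + #|K :\: A'|)%N by apply: c2 => //; set_cases.
  have e4 : #|L| = (#|A'| + #|L :\: A'|)%N by apply: c2 => //; set_cases.
  have f1 : #|I :\: A| = (#|C| + #|bI|)%N by apply: c2; set_cases.
  have f2 : #|J :\: A| = (#|C| + #|bJ|)%N by apply: c2; set_cases.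
  have f3 : #|K :\: A'| = (#|C| + #|bK|)%N by apply: c2; set_cases.
  have f4 : #|L :\: A'| = (#|C| + #|bL|)%N by apply: c2; set_cases.
  have g1 : #|bI| = (#|S1| + #|S2|)%N by apply: c2; set_cases.
  have g2 : #|bJ| = (#|S3| + #|S4|)%N by apply: c2; set_cases.
  have g3 : #|bK| = (#|S1| + #|S3|)%N by apply: c2; set_cases.
  have g4 : #|bL| = (#|S2| + #|S4|)%N by apply: c2; set_cases.
  nat_lia.

have [cAA' [c23 [c14 cm]]] := cA.
have [refl anti trans tot] := le_total.
(* The hypotheses compare [A] with [bI] and [bI] with [bJ]; chaining them needs
   an element in between, provided by [#|bI| = #|bJ|]. *)
have lt_trans x y z : (x != y) && le x y -> (y != z) && le y z ->
    (x != z) && le x z.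
  move=> /andP[xy lxy] /andP[yz lyz]; rewrite (trans _ _ _ lxy lyz) andbT.
  by apply: contraNneq xy => xz; apply/eqP/anti; rewrite lxy xz lyz.
have lt_asym x y : (x != y) && le x y -> (y != x) && le y x -> False.
  move=> /andP[/eqP xy lxy] /andP[_ lyx].
  by case: xy; apply: anti; rewrite lxy lyx.
have below0 B x : {in B, forall y, (x != y) && le x y} -> below le B x = set0.
  move=> ltxB; apply/setP => y; rewrite !inE; apply/negP => /andP[yB lt_yx].
  exact: lt_asym lt_yx (ltxB _ yB).
have belowT B x : {in B, forall y, (y != x) && le y x} -> below le B x = B.
  move=> ltBx; apply/setP => y; rewrite inE.
  by have [/ltBx ->|] := boolP (y \in B).
have card_bIJ : #|bI| = #|bJ|.
  have -> : bI = S1 :|: S2 by set_cases.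
  have -> : bJ = S3 :|: S4 by set_cases.
  rewrite !cardsU.
  have -> : S1 :&: S2 = set0 by set_cases.
  have -> : S3 :&: S4 = set0 by set_cases.
  by rewrite cards0; nat_lia.
have ltAJ : set_lt le A bJ.
  move=> x y xA yJ; have /card_gt0P[z zI] : (0 < #|bI|)%N.
    by rewrite card_bIJ; apply/card_gt0P; exists y.
  exact: lt_trans (ltA xA zI) (ltIJ zI yJ).
have ltID : set_lt le bI A'.
  move=> x y xI yA; have /card_gt0P[z zJ] : (0 < #|bJ|)%N.
    by rewrite -card_bIJ; apply/card_gt0P; exists x.
  exact: lt_trans (ltIJ xI zJ) (ltD zJ yA).
have strip1 : (n - m)`!%:R * Ex (fun X => D I J X * D K L X) =
    (n - m + #|A|)`!%:R * Ex (fun X => D (I :\: A) (J :\: A) X * D K L X).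
  transitivity ((n - #|I|)`!%:R * Ex (fun X => D K L X * D I J X)).
    by rewrite cardI; congr (_ * Ex _); apply/funext => X; rewrite mulrC.
  rewrite (@Ex_strip_common_rows A) ?cardI ?cardJ //.
  - by congr (_ * Ex _); apply/funext => X; rewrite mulrC.
  - by apply/subsetP => y; rewrite !inE => /andP[].
  - move=> t tA; have := symP t; move: tA; rewrite !inE => tA tS.
    apply: polyfun_gram_minorC1; first by rewrite cardK cardL.
      by move: tA tS; do 4! case: (t \in _).
    by move: tA tS; do 4! case: (t \in _).
  - move=> t tA.
    have -> : I :\: J = bI by set_cases.
    have -> : J :\: I = bJ by set_cases.
    by rewrite !below0 // => y; [exact: ltAJ|exact: ltA].
have cIA : #|I :\: A| = (m - #|A|)%N.
  have := cardsID A I; have -> : I :&: A = A by set_cases.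
  by nat_lia.
have cJA : #|J :\: A| = (m - #|A|)%N.
  have := cardsID A J; have -> : J :&: A = A by set_cases.
  by nat_lia.
have cKA : #|K :\: A'| = (m - #|A|)%N.
  have := cardsID A' K; have -> : K :&: A' = A' by set_cases.
  by nat_lia.
have cLA : #|L :\: A'| = (m - #|A|)%N.
  have := cardsID A' L; have -> : L :&: A' = A' by set_cases.
  by nat_lia.
have strip2 : (n - m)`!%:R * Ex (fun X => D (I :\: A) (J :\: A) X * D K L X) =
    (n - m + #|A|)`!%:R *
    Ex (fun X => D (I :\: A) (J :\: A) X * D (K :\: A') (L :\: A') X).
  rewrite -[X in (n - X)`!]cardK (@Ex_strip_common_rows A') ?cardK ?cardL ?cAA' //.
  - by apply/subsetP => y; rewrite !inE => /andP[].
  - move=> t tA; have := symP t; move: tA; rewrite !inE => tA tS.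
    apply: polyfun_gram_minorC1; first by rewrite cIA cJA.
      by rewrite !inE; move: tA tS; do 4! case: (t \in _).
    by rewrite !inE; move: tA tS; do 4! case: (t \in _).
  - move=> t tA.
    have lt_symdiff y : y \in symdiff K L -> (y != t) && le y t.
      rewrite -symdiffE => ySD; have [yI|yI] := boolP (y \in bI).
        exact: ltID.
      apply: ltD => //; move: ySD yI; rewrite !inE.
      by do 2! case: (y \in _).
    rewrite !belowT => [|y yB|y yB]; last 2 first.
    + by apply: lt_symdiff; rewrite inE yB orbT.
    + by apply: lt_symdiff; rewrite inE yB.
    have -> : K :\: L = S1 :|: S3 by set_cases.
    have -> : L :\: K = S2 :|: S4 by set_cases.
    rewrite !cardsU.
    have -> : S1 :&: S3 = set0 by set_cases.
    have -> : S2 :&: S4 = set0 by set_cases.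
    by rewrite cards0; nat_lia.
have ltS a b (U V : {set 'I_r}) : a \in U -> b \in V -> set_lt le U V ->
  (a != b) && le a b by move=> aU bV; exact.
have swap1 : (n - (m - #|A|))`!%:R *
    Ex (fun X => D (I :\: A) (J :\: A) X * D (K :\: A') (L :\: A') X) =
    #|S1|`!%:R * (n - (m - #|A|) + #|S1|)`!%:R *
    Ex (fun X => D (C :|: S2) (C :|: S3) X * D (C :|: S2) (C :|: S3) X).
  rewrite -cIA (@Ex_strip_paired_rows S1 S4) ?cIA ?cJA ?cKA ?cLA //.
  - congr (_ * Ex _); apply/funext => X.
    have -> : (I :\: A) :\: S1 = C :|: S2 by set_cases.
    have -> : (J :\: A) :\: S4 = C :|: S3 by set_cases.
    have -> : (K :\: A') :\: S1 = C :|: S3 by set_cases.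
    have -> : (L :\: A') :\: S4 = C :|: S2 by set_cases.
    congr (_ * _); apply: gram_minorC; rewrite !cardsU c23.
    have -> : C :&: S2 = set0 by set_cases.
    by have -> : C :&: S3 = set0 by set_cases.
  - by nat_lia.
  - by apply/subsetP => y; have := symP y; rewrite !inE; do 4! case: (y \in _).
  - by rewrite -setI_eq0; apply/eqP; set_cases.
  - by rewrite -setI_eq0; apply/eqP; set_cases.
  - by set_cases.
  - by apply/subsetP => y; have := symP y; rewrite !inE; do 4! case: (y \in _).
  - move=> x xS1.
    have -> : (I :\: A) :\: (K :\: A') = S2 by set_cases.
    have -> : (K :\: A') :\: (I :\: A) = S3 by set_cases.
    rewrite !below0 // => y yS; last exact: ltI.
    apply: ltIJ; first by move: xS1; rewrite inE => /andP[].
    by move: yS; rewrite inE => /andP[].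
  - move=> x xS4.
    have -> : (J :\: A) :\: (L :\: A') = S3 by set_cases.
    have -> : (L :\: A') :\: (J :\: A) = S2 by set_cases.
    rewrite !belowT // => y yS; last exact: ltJ.
    apply: ltIJ; last by move: xS4; rewrite inE => /andP[].
    by move: yS; rewrite inE => /andP[].
have cCS2 : #|C :|: S2| = (m - #|A| - #|S1|)%N.
  rewrite cardsU; have -> : C :&: S2 = set0 by set_cases.
  by rewrite cards0; nat_lia.
have cCS3 : #|C :|: S3| = (m - #|A| - #|S1|)%N.
  rewrite cardsU; have -> : C :&: S3 = set0 by set_cases.
  by rewrite cards0; nat_lia.
have swap2 : (n - (m - #|A| - #|S1|))`!%:R *
    Ex (fun X => D (C :|: S2) (C :|: S3) X * D (C :|: S2) (C :|: S3) X) =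
    #|S2|`!%:R * (n - (m - #|A| - #|S1|) + #|S2|)`!%:R *
    Ex (fun X => D C C X * D C C X).
  rewrite -cCS2 (@Ex_strip_paired_rows S2 S3) ?cCS2 ?cCS3 //.
  - congr (_ * Ex _); apply/funext => X.
    have -> : (C :|: S2) :\: S2 = C by set_cases.
    by have -> : (C :|: S3) :\: S3 = C by set_cases.
  - by nat_lia.
  - by apply/subsetP => y; have := symP y; rewrite !inE; do 4! case: (y \in _).
  - by rewrite -setI_eq0; apply/eqP; set_cases.
  - by rewrite -setI_eq0; apply/eqP; set_cases.
  - by set_cases.
  - by apply/subsetP => y; have := symP y; rewrite !inE; do 4! case: (y \in _).
have sq := @Ex_minor_square C.
have Cn : (#|C| <= n)%N by nat_lia.
move: strip1 strip2 swap1 swap2 (sq Cn).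
have -> : (n - (m - #|A|) = n - m + #|A|)%N by nat_lia.
have -> : (n - (m - #|A| - #|S1|) = n - m + #|A| + #|S1|)%N by nat_lia.
have -> : (n - m + #|A| + #|S1| + #|S2| = n - #|C|)%N by nat_lia.
have f_neq0 k : k`!%:R != 0 :> R by rewrite pnatr_eq0 -lt0n fact_gt0.
move=> E0 E1 E2 E3 E4; exact: (eliminate_chain _ _ _ _ _ E0 E1 E2 E3 E4).
Qed.

End Expectation.
End Recursion.

From mathcomp Require Import all_classical all_reals all_analysis.
From mathcomp Require Import measurable_realfun.
Import numFieldNormedType.Exports.

(** * Integration against a weighted image measure *)

Section Weight.
Local Open Scope classical_set_scope.
Local Open Scope ring_scope.
Context d d' (T : measurableType d) (U : measurableType d') (R : realType).
Variables (mu : {measure set T -> \bar R}) (nu : {measure set U -> \bar R}).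
Variables (h : T -> U) (g : T -> R).
Hypotheses (mh : measurable_fun [set: T] h) (mg : measurable_fun [set: T] g).
Hypothesis g0 : forall x, 0 <= g x.
Hypothesis gnu : forall B, measurable B ->
  (\int[mu]_(x in h @^-1` B) (g x)%:E = nu B)%E.

Import HBNNSimple.

(** If the image by [h] of the measure [g mu] is [nu], then integrals against [nu]
are weighted integrals against [mu]. This covers densities ([h] the identity),
image measures ([g] constant) and freezing all factors but one in a product
of independent variables. The hypothesis is the case of indicators;
simple functions and monotone limits follow. *)
Lemma ge0_integral_weight (f : U -> R) : measurable_fun [set: U] f ->
  (forall y, 0 <= f y) ->
  (\int[mu]_x (g x * f (h x))%:E = \int[nu]_y (f y)%:E)%E.
Proof.
move=> mf f0.
have mEf : measurable_fun [set: U] (EFin \o f) by exact/measurable_EFinP.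
pose f_ := nnsfun_approx measurableT mEf.
have cvgf y : (f_ n y)%:E @[n --> \oo] --> (f y)%:E.
  by apply: (cvg_nnsfun_approx measurableT mEf) => // z _; rewrite lee_fin.
transitivity (limn (fun n => \int[nu]_y (f_ n y)%:E)%E); last first.
  rewrite -monotone_convergence//.
  - by apply: eq_integral => y _; apply/cvg_lim => //; exact: cvgf.
  - by move=> n; exact/measurable_EFinP/measurable_funP.
  - by move=> n y _; rewrite lee_fin.
  - by move=> y _ m n mn; rewrite lee_fin; exact/lefP/nd_nnsfun_approx.
have mfh n : measurable_fun [set: T] (f_ n \o h).
  by apply: measurableT_comp => //; exact: measurable_funP.
transitivity (limn (fun n => \int[mu]_x (g x * f_ n (h x))%:E)%E).
  rewrite -monotone_convergence//.
  - apply: eq_integral => x _; apply/esym/cvg_lim => //.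
    under eq_fun do rewrite EFinM.
    by rewrite EFinM; apply: cvgeZl => //; exact: cvgf.
  - by move=> n; apply/measurable_EFinP; apply: measurable_funM => //; exact: mfh.
  - by move=> n x _; rewrite lee_fin mulr_ge0.
  - move=> x _ m n mn; rewrite lee_fin ler_wpM2l //.
    exact/lefP/nd_nnsfun_approx.
congr (limn _); apply/funext => n.
have mB r : measurable (f_ n @^-1` [set r]) by [].
have mI r : measurable_fun [set: T] (fun x => \1_(f_ n @^-1` [set r]) (h x) : R).
  apply: (measurableT_comp (f := \1_(f_ n @^-1` [set r]) : U -> R)).
    exact: measurable_indic.
  exact: mh.
transitivity (\sum_(k \in range (f_ n))
    \int[mu]_x (k * (g x * \1_(f_ n @^-1` [set k]) (h x)))%:E)%E.
  rewrite -ge0_integral_fsum//.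
  - apply: eq_integral => x _; rewrite fsumEFin// {1}fimfunE mulr_fsumr.
    by congr (_%:E); apply: eq_fsbigr => k _; rewrite mulrCA.
  - move=> k; apply/measurable_EFinP; apply: measurable_funM => //.
    exact: measurable_funM.
  - move=> k x _; rewrite lee_fin mulrCA mulr_ge0 //.
    by have := nnfun_muleindic_ge0 (f_ n) k (h x); rewrite -EFinM lee_fin.
transitivity (\sum_(k \in range (f_ n))
    \int[nu]_y (k * \1_(f_ n @^-1` [set k]) y)%:E)%E; last first.
  rewrite -ge0_integral_fsum//.
  - by apply: eq_integral => x _; rewrite fsumEFin// -fimfunE.
  - by move=> k; exact/measurable_EFinP/measurable_funM.
  - by move=> k x _; rewrite nnfun_muleindic_ge0.
apply: eq_fsbigr => k /[!inE] -[y _ <-{k}].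
under eq_integral do rewrite EFinM.
rewrite ge0_integralZl_EFin//; last 2 first.
  by move=> x _; rewrite lee_fin mulr_ge0.
  by apply/measurable_EFinP; exact: measurable_funM.
rewrite integralZl_indic_nnsfun// integral_indic// setIT -gnu//.
congr (_ * _)%E; rewrite [RHS]integral_mkcond; apply: eq_integral => x _.
rewrite patchE /= indicE.
have -> : (h x \in f_ n @^-1` [set f_ n y]) =
  (x \in h @^-1` (f_ n @^-1` [set f_ n y])) by [].
by case: ifP => _; rewrite ?mulr1 ?mulr0.
Qed.

Lemma integral_weight (f : U -> R) : measurable_fun [set: U] f ->
  (\int[mu]_x (g x * f (h x))%:E = \int[nu]_y (f y)%:E)%E.
Proof.
move=> mf; rewrite [LHS]integralE [RHS]integralE.
have maxM x (y : R) : Num.max (g x * y) 0 = g x * Num.max y 0.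
  by rewrite maxr_pMr // mulr0.
congr (_ - _)%E.
  transitivity (\int[nu]_y (Num.max (f y) 0)%:E)%E; last first.
    by apply: eq_integral => y _; rewrite funeposE EFin_max.
  rewrite -ge0_integral_weight.
  - by apply: eq_integral => x _; rewrite funeposE -maxM EFin_max.
  - exact: measurable_maxr.
  - by move=> y; rewrite le_max lexx orbT.
transitivity (\int[nu]_y (Num.max (- f y) 0)%:E)%E; last first.
  by apply: eq_integral => y _; rewrite funenegE EFin_max EFinN.
rewrite -(ge0_integral_weight (f := fun y => Num.max (- f y) 0)).
- by apply: eq_integral => x _; rewrite funenegE -maxM mulrN EFin_max EFinN.
- by apply: measurable_maxr => //; exact: measurableT_comp.
- by move=> y; rewrite le_max lexx orbT.
Qed.

Lemma integrable_weight (f : U -> R) : measurable_fun [set: U] f ->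
  mu.-integrable [set: T] (fun x => (g x * f (h x))%:E) ->
  nu.-integrable [set: U] (EFin \o f).
Proof.
move=> mf /integrableP[_ fin]; apply/integrableP; split.
  exact/measurable_EFinP.
rewrite [ltLHS](_ : _ = (\int[nu]_y (`|f y|)%:E)%E) //.
rewrite -(ge0_integral_weight (f := fun y => `|f y|)) //; last first.
  exact: measurableT_comp.
apply: le_lt_trans fin; rewrite le_eqVlt; apply/orP; left; apply/eqP.
by apply: eq_integral => x _; rewrite /= normrM (ger0_norm (g0 _)).
Qed.

End Weight.

(** * Moments of the standard normal law *)

Section Moments.
Local Open Scope classical_set_scope.
Local Open Scope ring_scope.
Variable R : realType.
Local Notation mu := (@lebesgue_measure R).
Local Notation phi := (@normal_pdf R 0 1).

(** The integral over [[-n, n]] is [F n - F (-n)], which tends to 0; as [f] is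
integrable it also tends to the integral over the line. *)
Lemma integral_derivative_eq0 (F f : R -> R) :
  (forall x : R, is_derive x (1 : R) F (f x)) -> continuous f ->
  mu.-integrable [set: R] (EFin \o f) ->
  F n.+1%:R @[n --> \oo] --> 0 -> F (- n.+1%:R) @[n --> \oo] --> 0 ->
  (\int[mu]_x (f x)%:E = 0)%E.
Proof.
move=> dF cf intf Fy FNy.
pose I n : set R := [set` `[- n.+1%:R, n.+1%:R]].
have intI n : (\int[mu]_(x in I n) (f x)%:E = (F n.+1%:R - F (- n.+1%:R))%:E)%E.
  rewrite (@continuous_FTC2 _ f F); first by rewrite EFinB.
  - by rewrite ltrNl (@lt_trans _ _ 0) // ?oppr_lt0.
  - exact: continuous_subspaceT.
  - have cF x : F @ x --> F x.
      by apply: differentiable_continuous; apply/derivable1_diffP.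
    split=> [x _||]; first exact: ex_derive.
      exact: cvg_at_right_filter.
    exact: cvg_at_left_filter.
  - by move=> x _; rewrite derive1E derive_val.
have mf : measurable_fun [set: R] (EFin \o f) by exact: measurable_int intf.
have : (\int[mu]_x ((EFin \o f) \_ (I n)) x @[n --> \oo] --> \int[mu]_x (f x)%:E)%E.
  have [] // := @dominated_convergence _ _ _ mu setT measurableT
    (fun n => (EFin \o f) \_ (I n)) (EFin \o f) (abse \o (EFin \o f)).
  - move=> n; apply/(measurable_restrictT _ _).1 => //.
      exact: measurable_itv.
    exact: measurable_funTS.
  - apply: aeW => x _; apply: cvg_near_cst; near=> n.
    rewrite patchE ifT // inE /I /= in_itv /= -ler_norml.
    apply: (@le_trans _ _ n%:R); last by rewrite ler_nat.
    by apply: ltW; near: n; exact: nbhs_infty_gtr.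
  - exact: integrable_abse.
  - apply: aeW => x n _; rewrite patchE; case: ifP => _ //=.
    by rewrite normr0 lee_fin.
have -> : (fun n => \int[mu]_x ((EFin \o f) \_ (I n)) x)%E =
          (fun n => (F n.+1%:R - F (- n.+1%:R))%:E).
  by apply/funext => n; rewrite -integral_mkcond intI.
move=> /cvg_lim <- //; apply/cvg_lim => //; apply: cvg_EFin.
  exact: nearW.
by rewrite -[X in _ --> X](subr0 0); exact: cvgB.
Unshelve. all: by end_near. Qed.


Lemma std_normal_pdfE x : phi x = normal_peak 1 * expR (- x ^+ 2 / 2).
Proof.
by rewrite normal_pdfE ?oner_eq0 // /normal_fun subr0 expr1n mulr2n.
Qed.

(** Exponential tilting of the standard normal density by [t] is, up to a constant,
the normal density centred at [t]. *)
Lemma std_normal_pdf_tilt (t x : R) :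
  expR (t * x) * phi x = expR (t ^+ 2 / 2) * normal_pdf t 1 x.
Proof.
rewrite std_normal_pdfE normal_pdfE ?oner_eq0 // /normal_fun expr1n.
rewrite mulrCA [RHS]mulrCA -!expRD; congr (_ * expR _).
by rewrite -[1 *+ 2]/(2%:R); field.
Qed.

Let bound k (x : R) : R := k`!%:R * expR (1 / 2) *
  (normal_pdf 1 1 x + normal_pdf (-1) 1 x).

(** The power series of the exponential gives [|x|^k <= k! (e^x + e^-x)], and the
exponentials turn the density into translated normal densities, which are
integrable and bounded. *)
Lemma std_normal_monomial_le k (x : R) : `|x| ^+ k * phi x <= bound k x.
Proof.
have le_exp (y : R) : 0 <= y -> y ^+ k <= k`!%:R * expR y.
  move=> y0; case: k => [|k].
    by rewrite fact0 mul1r (le_trans _ (expR_ge1Dx y)) // lerDl.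
  rewrite -ler_pdivrMl ?ltr0n ?fact_gt0 // mulrC.
  by apply: le_trans (expR_ge1Dxn k y0); rewrite lerDr.
have e1 (t : R) : t ^+ 2 = 1 ->
    expR (1 / 2) * normal_pdf t 1 x = expR (t * x) * phi x.
  by move=> t1; rewrite std_normal_pdf_tilt t1.
rewrite /bound -mulrA mulrDr !e1 ?sqrrN ?expr1n // -mulrDl mulrA.
apply: ler_wpM2r; first exact: normal_pdf_ge0.
apply: le_trans (le_exp _ (normr_ge0 x)) _; apply: ler_wpM2l => //.
rewrite mul1r mulN1r; have [x0|x0] := ger0P x.
  by rewrite lerDl expR_ge0.
by rewrite lerDr expR_ge0.
Qed.

Lemma integrable_std_normal_monomial k :
  mu.-integrable [set: R] (fun x => (x ^+ k * phi x)%:E).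
Proof.
have intB : mu.-integrable [set: R] (fun x => (bound k x)%:E).
  under eq_fun do rewrite EFinM EFinD.
  apply: integrableZl => //; apply: integrableD => //;
    exact: integrable_normal_pdf.
apply: (le_integrable measurableT _ _ intB).
- apply/measurable_EFinP; apply: measurable_funM; first exact: exprn_measurable.
  exact: measurable_normal_pdf.
- move=> x _ /=; rewrite lee_fin normrM normrX.
  rewrite (ger0_norm (normal_pdf_ge0 _ _ _)).
  by apply: le_trans (std_normal_monomial_le k x) _; exact: ler_norm.
Qed.

(** The bound in degree [k.+1] gives a decay in [1 / |x|] in degree [k]. *)
Lemma std_normal_monomial_cvg0 k (u : nat -> R) :
  (forall n, `|u n| = n.+1%:R) -> u n ^+ k * phi (u n) @[n --> \oo] --> 0.
Proof.
move=> un; pose C := k.+1`!%:R * expR (1 / 2) * (normal_peak 1 *+ 2) : R.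
apply/norm_cvg0P.
apply: (@squeeze_cvgr _ _ _ _ (fun=> 0) (fun n => C * n.+1%:R^-1)).
- apply: nearW => n; rewrite normr_ge0 /= normrM normrX.
  rewrite (ger0_norm (normal_pdf_ge0 _ _ _)) ler_pdivlMr ?ltr0n //.
  rewrite mulrAC -(un n) -exprSr.
  apply: le_trans (std_normal_monomial_le _ _) _.
  rewrite /bound /C ler_wpM2l ?mulr_ge0 ?expR_ge0 // mulr2n lerD //.
    by rewrite normal_pdf_ub ?oner_eq0.
  by rewrite normal_pdf_ub ?oner_eq0.
- exact: cvg_cst.
- by rewrite -[X in _ --> X](mulr0 C); apply: cvgMr; exact: cvg_harmonic.
Qed.

Lemma is_derive_std_normal_pdf (x : R) : is_derive x 1 phi (- (x * phi x)).
Proof.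
have -> : phi = normal_peak 1 \*: (expR \o ((- 2^-1) \*: (@id R * @id R))).
  apply/funext => y; rewrite std_normal_pdfE /= expr2; congr (_ * expR _).
  by rewrite -[RHS]/(- 2^-1 * (y * y)) mulNr mulNr mulrC.
apply: is_derive_eq; rewrite /= /GRing.scale /=.
by set E := expR _; field.
Qed.

(** The integrand is minus the derivative of the density. *)
Lemma integral_std_normal_id : (\int[mu]_x (x * phi x)%:E = 0)%E.
Proof.
have cphi : continuous phi by apply: continuous_normal_pdf; rewrite oner_eq0.
have inti := integrable_std_normal_monomial 1.
have cvg0 (u : nat -> R) : (forall n, `|u n| = n.+1%:R) ->
    phi (u n) @[n --> \oo] --> 0.
  move=> un; have := std_normal_monomial_cvg0 0 un.
  by under eq_fun do rewrite expr0 mul1r.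
suff : (\int[mu]_x (- (x * phi x))%:E = 0)%E.
  under eq_integral do rewrite EFinN.
  rewrite integralN /=.
    by move/eqP; rewrite oppe_eq0 => /eqP.
  exact: integrable_add_def.
apply: (@integral_derivative_eq0 phi).
- exact: is_derive_std_normal_pdf.
- by move=> x; apply: cvgN; apply: cvgM; [exact: cvg_id|exact: cphi].
- exact: integrableN inti.
- by apply: cvg0 => n; rewrite ger0_norm.
- by apply: cvg0 => n; rewrite normrN ger0_norm.
Qed.

(** Integration by parts: [x^(k+1) phi] has derivative
[(k+1) x^k phi - x^(k+2) phi]. *)
Lemma integral_std_normal_step k :
  (\int[mu]_x (x ^+ k.+2 * phi x)%:E =
   k.+1%:R%:E * \int[mu]_x (x ^+ k * phi x)%:E)%E.
Proof.
have cphi : continuous phi by apply: continuous_normal_pdf; rewrite oner_eq0.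
have ik := integrable_std_normal_monomial k.
have ik2 := integrable_std_normal_monomial k.+2.
have : (\int[mu]_x (k.+1%:R * (x ^+ k * phi x) - x ^+ k.+2 * phi x)%:E = 0)%E.
  apply: (@integral_derivative_eq0 (fun x => x ^+ k.+1 * phi x)).
  - move=> x; have dphi := is_derive_std_normal_pdf x.
    have -> : (fun x => x ^+ k.+1 * phi x) = (@id R ^+ k.+1) * phi.
      by rewrite exprfctE.
    apply: is_derive_eq.
    by rewrite exprfctE /GRing.scale /= !exprS; ring.
  - have cX j : continuous (fun x : R => x ^+ j * phi x).
      by move=> x; apply: cvgM; [exact: exprn_continuous|exact: cphi].
    move=> x; apply: cvgB; last exact: cX.
    by apply: cvgM; [exact: cvg_cst|exact: cX].
  - have -> : EFin \o (fun x => k.+1%:R * (x ^+ k * phi x) - x ^+ k.+2 * phi x) =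
        (fun x => (k.+1%:R)%:E * (x ^+ k * phi x)%:E - (x ^+ k.+2 * phi x)%:E)%E.
      by apply/funext => x; rewrite /= EFinB EFinM.
    by apply: integrableB => //; exact: integrableZl.
  - by apply: std_normal_monomial_cvg0 => n; rewrite ger0_norm.
  - by apply: std_normal_monomial_cvg0 => n; rewrite normrN ger0_norm.
under eq_integral do rewrite EFinB EFinM.
rewrite integralB //; last exact: integrableZl.
rewrite integralZl //.
have := integrable_fin_num measurableT ik.
have := integrable_fin_num measurableT ik2.
move: (integral _ _ _) (integral _ _ _) => [a| |] [b| |] //= _ _.
by rewrite -EFinM -EFinB => -[/eqP]; rewrite subr_eq0 => /eqP ->.
Qed.

End Moments.

Section StdNormalMoments.
Local Open Scope classical_set_scope.
Local Open Scope ring_scope.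
Variable R : realType.
Local Notation N := (@normal_prob R 0 1).
Local Notation mu := (@lebesgue_measure R).
Local Notation phi := (@normal_pdf R 0 1).

Definition std_moment (k : nat) : R := fine (\int[N]_x (x ^+ k)%:E)%E.

Lemma integral_std_normal (f : R -> R) : measurable_fun [set: R] f ->
  (\int[N]_x (f x)%:E = \int[mu]_x (f x * phi x)%:E)%E.
Proof.
move=> mf.
rewrite -(@integral_weight _ _ _ _ _ mu N idfun phi) //.
- by apply: eq_integral => x _; rewrite mulrC.
- exact: measurable_id.
- exact: measurable_normal_pdf.
- by move=> x; exact: normal_pdf_ge0.
Qed.

Lemma integrable_std_normal_pow k :
  (N : {measure set _ -> \bar R}).-integrable [set: R] (fun x => (x ^+ k)%:E).
Proof.
apply: (@integrable_weight _ _ _ _ _ mu N idfun phi) => //.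
- exact: measurable_id.
- exact: measurable_normal_pdf.
- by move=> x; exact: normal_pdf_ge0.
- under eq_fun do rewrite mulrC; exact: integrable_std_normal_monomial.
Qed.

Lemma std_momentEpdf k : std_moment k = fine (\int[mu]_x (x ^+ k * phi x)%:E)%E.
Proof. by rewrite /std_moment integral_std_normal. Qed.

Lemma std_moment0 : std_moment 0 = 1.
Proof.
rewrite std_momentEpdf; under eq_integral do rewrite expr0 mul1r.
by rewrite integral_normal_pdf.
Qed.

Lemma std_moment1 : std_moment 1 = 0.
Proof.
rewrite std_momentEpdf; under eq_integral do rewrite expr1.
by rewrite integral_std_normal_id.
Qed.

Lemma std_momentSS k : std_moment k.+2 = k.+1%:R * std_moment k.
Proof.
rewrite !std_momentEpdf integral_std_normal_step fineM //.
by apply: integrable_fin_num => //; exact: integrable_std_normal_monomial.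
Qed.

Lemma std_moment2 : std_moment 2 = 1.
Proof. by rewrite std_momentSS std_moment0 mulr1. Qed.

Lemma std_moment4 : std_moment 4 = 3.
Proof. by rewrite std_momentSS std_moment2 mulr1. Qed.

End StdNormalMoments.

(** * Products of independent variables *)

Section ProductOfIndependent.
Local Open Scope classical_set_scope.
Local Open Scope ring_scope.
Context d (Omega : measurableType d) (R : realType).
Variables (P : probability Omega R) (I : finType).
Variables (N : probability (measurableTypeR R) R) (Y : I -> Omega -> R).
Hypothesis mY : forall i, measurable_fun [set: Omega] (Y i).
Hypothesis boxY : forall B : I -> set R, (forall i, measurable (B i)) ->
  P [set w | forall i, B i (Y i w)] = (\prod_(i : I) N (B i))%E.

Let J (f : R -> R) : R := fine (\int[N]_x (f x)%:E)%E.

Let JE f : N.-integrable [set: R] (EFin \o f) ->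
  (\int[N]_x (f x)%:E = (J f)%:E)%E.
Proof. by move=> intf; rewrite fineK // integrable_fin_num. Qed.

(** The indicators are replaced by general factors one index at a time, along the
list [s]. Freezing all factors but the one at [i0] defines a measure
[B |-> E[(other factors) 1_B (Y i0)]], which is a multiple of [N] by the
induction hypothesis applied to an indicator at [i0]; [ge0_integral_weight]
then passes from indicators to the factor at [i0]. *)
Lemma ge0_integral_prod_indep (s : seq I) (G : I -> R -> R) :
  (forall i, measurable_fun [set: R] (G i)) -> (forall i x, 0 <= G i x) ->
  (forall i, N.-integrable [set: R] (EFin \o G i)) ->
  (forall i, i \notin s -> exists2 B, measurable B & G i = \1_B) ->
  (\int[P]_w (\prod_i G i (Y i w))%:E = (\prod_i J (G i))%:E)%E.
Proof.
elim: s G => [|i0 s IHs] G mG G0 intG indG.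
  have /choice [B HB] : forall i, exists B, measurable B /\ G i = \1_B.
    by move=> i; have [//|B mB GB] := indG i; exists B.
  have mB i : measurable (B i) by have [] := HB i.
  have GB i : G i = \1_(B i) by have [] := HB i.
  have JB i : (N (B i) = (J (G i))%:E)%E.
    rewrite -JE; last exact: intG.
    by rewrite GB integral_indic ?setIT; [|exact: measurableT|exact: mB].
  have -> : (\prod_i J (G i))%:E = (\prod_i N (B i))%E.
    rewrite (big_morph EFin (id1 := 1%E) (op1 := mule)) //.
    by apply: eq_bigr => i _; rewrite JB.
  rewrite -boxY //.
  have mE : measurable [set w | forall i, B i (Y i w)].
    have -> : [set w | forall i, B i (Y i w)] =
        \bigcap_(i in [set: I]) (Y i @^-1` B i).
      by apply/seteqP; split=> [w Bw i _|w Bw i]; [exact: Bw|exact: (Bw i)].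
    apply: fin_bigcap_measurable => // i _.
    by rewrite -[_ @^-1` _]setTI; exact: mY.
  rewrite -[X in P X]setIT -integral_indic //.
  apply: eq_integral => w _; congr (_%:E).
  under eq_bigr do rewrite GB indicE.
  rewrite indicE; have [/set_mem Bw|nBw] := boolP (w \in _).
    by rewrite big1 // => i _; rewrite mem_set //; exact: Bw.
  have /existsNP[i nBi] : ~ forall i, B i (Y i w).
    by move=> Bw; move/negP: nBw; apply; exact/mem_set.
  by rewrite (bigD1 i) //= memNset // mul0r.
have [i0s|i0s] := boolP (i0 \in s).
  apply: IHs => // i si; apply: indG; rewrite inE negb_or si andbT.
  by apply: contraNneq si => ->.
(* Total mass of the measure obtained by freezing the other factors. *)
pose c := \prod_(i | i != i0) J (G i).
have J0 i : 0 <= J (G i).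
  by apply: fine_ge0; apply: integral_ge0 => x _; rewrite lee_fin.
have c0 : 0 <= c by apply: prodr_ge0.
have mg : measurable_fun [set: Omega] (fun w => \prod_(i | i != i0) G i (Y i w)).
  rewrite (_ : (fun w => _) = (fun w =>
      \prod_(i <- [seq i <- index_enum I | i != i0]) G i (Y i w))).
    by apply: measurable_prod => i _; apply: measurableT_comp.
  by apply/funext => w; rewrite big_filter.
transitivity (\int[P]_w ((\prod_(i | i != i0) G i (Y i w)) * G i0 (Y i0 w))%:E)%E.
  by apply: eq_integral => w _; rewrite (bigD1 i0) //= mulrC.
rewrite (@ge0_integral_weight _ _ _ _ _ P (mscale (NngNum c0) N) (Y i0)) //.
- rewrite ge0_integral_mscale //=; last 2 first.
  + by apply/measurable_EFinP; exact: mG.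
  + by move=> x _; rewrite lee_fin.
  by rewrite JE // -EFinM (bigD1 i0) //= mulrC.
- exact: mY.
- by move=> w; apply: prodr_ge0.
(* With an indicator at [i0], only the indices of [s] carry general factors. *)
- move=> B mB; pose G' i := if i == i0 then \1_B else G i.
  have mG' i : measurable_fun [set: R] (G' i).
    by rewrite /G'; case: ifP => // _; exact: measurable_indic.
  transitivity (\int[P]_w (\prod_i G' i (Y i w))%:E)%E.
    rewrite integral_mkcond; apply: eq_integral => w _; rewrite patchE.
    rewrite [in RHS](bigD1 i0) //= {1}/G' eqxx indicE.
    have -> : (Y i0 w \in B) = (w \in Y i0 @^-1` B) by [].
    case: ifP => _; rewrite ?mul1r ?mul0r //; congr (_%:E).
    by apply: eq_bigr => i /negPf ii0; rewrite /G' ii0.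
  rewrite IHs //.
  + rewrite (bigD1 i0) //= {1}/G' eqxx /mscale /= -/c.
    have -> : \prod_(i | i != i0) J (G' i) = c.
      by apply: eq_bigr => i /negPf ii0; rewrite /G' ii0.
    rewrite mulrC EFinM; congr (_ * _)%E.
    rewrite -JE; first by rewrite integral_indic // setIT.
    exact: integrable_indic.
  + by move=> i x; rewrite /G'; case: ifP.
  + by move=> i; rewrite /G'; case: ifP => // _; exact: integrable_indic.
  + move=> i si; rewrite /G'; case: eqP => [_|/eqP ii0]; first by exists B.
    by apply: indG; rewrite inE negb_or ii0.
- exact: mG.
Qed.

Lemma integrable_prod_indep (F : I -> R -> R) :
  (forall i, measurable_fun [set: R] (F i)) ->
  (forall i, N.-integrable [set: R] (EFin \o F i)) ->
  P.-integrable [set: Omega] (fun w => (\prod_i F i (Y i w))%:E).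
Proof.
move=> mF intF; apply/integrableP; split.
  apply/measurable_EFinP; apply: measurable_prod => i _.
  by apply: measurableT_comp; [exact: mF|exact: mY].
rewrite [ltLHS](_ : _ = (\int[P]_w (\prod_i `|F i (Y i w)|)%:E)%E); last first.
  by apply: eq_integral => w _; rewrite /= normr_prod.
rewrite (@ge0_integral_prod_indep (enum I) (fun i x => `|F i x|)) ?ltry //.
- by move=> i; apply: measurableT_comp; [exact: normr_measurable|exact: mF].
- by move=> i; have := integrable_abse (intF i).
- by move=> i; rewrite mem_enum.
Qed.

(** Each factor is split into positive and negative parts, the product is expanded
over all choices of parts, and the nonnegative case applies to each choice. *)
Lemma integral_prod_indep (F : I -> R -> R) :
  (forall i, measurable_fun [set: R] (F i)) ->
  (forall i, N.-integrable [set: R] (EFin \o F i)) ->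
  (\int[P]_w (\prod_i F i (Y i w))%:E = (\prod_i J (F i))%:E)%E.
Proof.
move=> mF intF.
pose H (b : bool) i (x : R) : R :=
  if b then Num.max (- F i x) 0 else Num.max (F i x) 0.
have HF i x : F i x = \sum_b (-1) ^+ nat_of_bool b * H b i x.
  rewrite big_bool /H /= expr1 expr0 mul1r mulN1r.
  have [F0|F0] := ger0P (F i x).
    by rewrite max_r ?oppr_le0 // oppr0 add0r.
  by rewrite max_l ?oppr_ge0 ?ltW // opprK addr0.
have mH b i : measurable_fun [set: R] (H b i).
  rewrite /H; case: b; apply: measurable_maxr; try exact: measurable_cst.
    by apply: measurableT_comp => //; exact: mF.
  exact: mF.
have intH b i : N.-integrable [set: R] (EFin \o H b i).
  apply: (le_integrable measurableT _ _ (intF i)).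
    by apply/measurable_EFinP; exact: mH.
  move=> x _; rewrite /= lee_fin /H.
  have [F0|] := boolP (0 <= F i x); last rewrite -ltNge => F0; case: b.
  - by rewrite max_r ?oppr_le0 // normr0 normr_ge0.
  - by rewrite max_l.
  - by rewrite max_l ?normrN // oppr_ge0 ltW.
  - by rewrite (max_r (ltW F0)) normr0 normr_ge0.
have H0 b i x : 0 <= H b i x by rewrite /H; case: b; rewrite le_max lexx orbT.
have JH i : J (F i) = \sum_b (-1) ^+ nat_of_bool b * J (H b i).
  rewrite big_bool /= expr1 expr0 mul1r mulN1r /J.
  under eq_integral
    do rewrite HF big_bool /= expr1 expr0 mul1r mulN1r EFinD EFinN addeC.
  have intP := intH false i; have intN := intH true i.
  rewrite integralB //=.
  rewrite fineB; [by rewrite [RHS]addrC|exact: integrable_fin_num intP|].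
  exact: integrable_fin_num intN.
pose K (f : {ffun I -> bool}) w := \prod_i H (f i) i (Y i w).
have intK f : P.-integrable [set: Omega] (fun w => (K f w)%:E).
  apply: (@integrable_prod_indep (fun i => H (f i) i)) => i; first exact: mH.
  exact: intH.
transitivity (\int[P]_w (\sum_(f : {ffun I -> bool})
    (\prod_i (-1) ^+ nat_of_bool (f i))%:E * (K f w)%:E))%E.
  apply: eq_integral => w _.
  rewrite (eq_bigr _ (fun i _ => HF i (Y i w))) bigA_distr_bigA /= -sumEFin.
  by apply: eq_bigr => f _; rewrite big_split EFinM.
rewrite integral_sum //; last by move=> f; exact: integrableZl.
rewrite (eq_bigr _ (fun i _ => JH i)) bigA_distr_bigA /= -sumEFin.
apply: eq_bigr => f _; rewrite integralZl // big_split EFinM; congr (_ * _)%E.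
apply: (@ge0_integral_prod_indep (enum I) (fun i => H (f i) i)) => //.
by move=> i; rewrite mem_enum.
Qed.

End ProductOfIndependent.

(** * The mean over a standard normal matrix *)

Section MatrixMeasurability.
Local Open Scope classical_set_scope.
Local Open Scope ring_scope.

Lemma measurable_mx_entry d (T : measurableType d) p q i j :
  measurable_fun [set: 'M[T]_(p, q)] (fun A : 'M[T]_(p, q) => A i j).
Proof.
move=> _ B mB; rewrite setTI; apply: sub_sigma_algebra.
by exists (i, j) => //; exists B => //; rewrite setTI.
Qed.

(** The coordinate maps generate the sigma-algebra of matrices. *)
Lemma measurable_fun_mx d d' (Omega : measurableType d') (T : measurableType d)
    p q (f : Omega -> 'M[T]_(p, q)) :
  (forall i j, measurable_fun [set: Omega] (fun w => f w i j)) ->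
  measurable_fun [set: Omega] f.
Proof.
move=> mf; apply: measurability; first by [].
move=> _ [_ [[i j] _ [B mB <-]] <-]; rewrite !setTI.
by have := mf i j measurableT B mB; rewrite setTI.
Qed.

End MatrixMeasurability.

Section PolyfunMeasurable.
Local Open Scope classical_set_scope.
Local Open Scope ring_scope.
Variables (R : realType) (r n : nat).

Lemma polyfun_measurable Q (f : 'M[R]_(r, n) -> R) :
  polyfun Q f -> measurable_fun [set: 'M[R]_(r, n)] f.
Proof.
elim=> [c|i a _|g h _ mg _ mh|g h _ mg _ mh].
- exact: measurable_cst.
- exact: measurable_mx_entry.
- exact: measurable_funD.
- exact: measurable_funM.
Qed.

(** The mean of a polynomial is known on monomials only, as a product of moments;
this normal form reduces every statement about means to monomials. The
exponents vanish on the rows that the polynomial does not involve. *)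
Lemma polyfun_monomials Q (f : 'M[R]_(r, n) -> R) : polyfun Q f ->
  exists (K : finType) (c : K -> R) (e : K -> 'I_r * 'I_n -> nat),
    (forall k i a, ~~ Q i -> e k (i, a) = 0%N) /\
    f = fun X => \sum_k c k * \prod_(ij : 'I_r * 'I_n) X ij.1 ij.2 ^+ e k ij.
Proof.
elim=> [c|i a Qi|g h _ IHg _ IHh|g h _ IHg _ IHh].
- exists unit, (fun=> c), (fun _ _ => 0%N); split=> //.
  apply/funext => X; rewrite big_const card_unit /= addr0 big1 ?mulr1 //.
- exists unit, (fun=> 1), (fun _ ij => (ij == (i, a)) : nat); split.
    by move=> _ j b; case: eqP => [[-> _]|//]; rewrite Qi.
  apply/funext => X; rewrite big_const card_unit /= addr0 mul1r.
  rewrite (bigD1 (i, a)) //= eqxx expr1 big1 ?mulr1 // => ij /negPf ->.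
  by rewrite expr0.
- have [K1 [c1 [e1 [Q1 ->]]]] := IHg; have [K2 [c2 [e2 [Q2 ->]]]] := IHh.
  exists (K1 + K2)%type, (fun k => match k with inl k => c1 k | inr k => c2 k end),
    (fun k => match k with inl k => e1 k | inr k => e2 k end); split.
    by move=> [k|k] j b; [exact: Q1|exact: Q2].
  by apply/funext => X; rewrite big_sumType.
- have [K1 [c1 [e1 [Q1 ->]]]] := IHg; have [K2 [c2 [e2 [Q2 ->]]]] := IHh.
  exists (K1 * K2)%type, (fun k => c1 k.1 * c2 k.2),
    (fun k ij => (e1 k.1 ij + e2 k.2 ij)%N); split.
    by move=> k j b Qj; rewrite Q1 // Q2.
  apply/funext => X; rewrite big_distrlr /= pair_big /=; apply: eq_bigr => k _.
  rewrite mulrACA -big_split; congr (_ * _); apply: eq_bigr => ij _.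
  by rewrite exprD.
Qed.

End PolyfunMeasurable.

Section GaussianMatrix.
Local Open Scope classical_set_scope.
Local Open Scope ring_scope.
Context d (Omega : measurableType d) (R : realType) (P : probability Omega R).
Variables (r n : nat) (X : {RV P >-> 'M[R]_(r, n)}).
Hypothesis indep : independent_family P (fun (j : 'I_n) w => col j (X w)).
Hypothesis normal : forall j : 'I_n,
  is_std_normal_vector (pushforward P (fun w => col j (X w))).

Local Notation N := (@normal_prob R 0 1).

Let mX i j : measurable_fun [set: Omega] (fun w => X w i j).
Proof.
by apply: (measurableT_comp (@measurable_mx_entry _ _ _ _ i j)).
Qed.

Let box (B : 'I_r * 'I_n -> set R) : (forall ij, measurable (B ij)) ->
  P [set w | forall ij, B ij (X w ij.1 ij.2)] = (\prod_ij N (B ij))%E.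
Proof.
move=> mB.
pose C (j : 'I_n) : set 'cV[R]_r := [set x | forall i, B (i, j) (x i ord0)].
have mC j : measurable (C j).
  have -> : C j = \bigcap_(i in [set: 'I_r])
      ((fun x : 'cV[R]_r => x i ord0) @^-1` B (i, j)).
    by apply/seteqP; split=> [x Cx i _|x Cx i]; [exact: Cx|exact: (Cx i)].
  apply: fin_bigcap_measurable => // i _.
  by rewrite -[_ @^-1` _]setTI; apply: measurable_mx_entry.
have -> : [set w | forall ij, B ij (X w ij.1 ij.2)] =
    [set w | forall j, C j (col j (X w))].
  apply/seteqP; split=> w Bw.
    by move=> j i; rewrite mxE; exact: (Bw (i, j)).
  by move=> [i j]; have := Bw j i; rewrite mxE.
rewrite indep // [RHS](eq_bigr (fun ij => N (B (ij.1, ij.2)))); last by case.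
rewrite -(pair_bigA _ (fun i j => N (B (i, j)))) /=.
by rewrite exchange_big; apply: eq_bigr => j _; exact: normal.
Qed.

Let intX e : P.-integrable [set: Omega]
  (fun w => (\prod_(ij : 'I_r * 'I_n) X w ij.1 ij.2 ^+ e ij)%:E).
Proof.
apply: (@integrable_prod_indep _ _ _ _ _ N (fun ij w => X w ij.1 ij.2) _ box
  (fun ij x => x ^+ e ij)) => [ij|ij|ij].
- exact: mX.
- exact: exprn_measurable.
- exact: integrable_std_normal_pow.
Qed.

Let intXE e : (\int[P]_w (\prod_(ij : 'I_r * 'I_n) X w ij.1 ij.2 ^+ e ij)%:E =
  (\prod_ij std_moment R (e ij))%:E)%E.
Proof.
apply: (@integral_prod_indep _ _ _ _ _ N (fun ij w => X w ij.1 ij.2) _ box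
  (fun ij x => x ^+ e ij)) => [ij|ij|ij].
- exact: mX.
- exact: exprn_measurable.
- exact: integrable_std_normal_pow.
Qed.

Lemma polyfun_integrable f : polyfun predT f ->
  P.-integrable [set: Omega] (fun w => (f (X w))%:E).
Proof.
move=> /polyfun_monomials[K [c [e [_ ->]]]].
under eq_fun do rewrite -sumEFin.
apply: integrable_sum => // k _; under eq_fun do rewrite EFinM.
exact: integrableZl.
Qed.

Definition mean (f : 'M[R]_(r, n) -> R) : R := fine (\int[P]_w (f (X w))%:E)%E.

Lemma integral_mean f : polyfun predT f ->
  (\int[P]_w (f (X w))%:E = (mean f)%:E)%E.
Proof.
by move=> Pf; rewrite fineK //; apply/integrable_fin_num/polyfun_integrable.
Qed.

Let meanD f g : polyfun predT f -> polyfun predT g ->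
  mean (fun X => f X + g X) = mean f + mean g.
Proof.
move=> Pf Pg; rewrite /mean; under eq_integral do rewrite EFinD.
by rewrite integralD //=; [rewrite !integral_mean|exact: polyfun_integrable..].
Qed.

Let meanZ c f : polyfun predT f -> mean (fun X => c * f X) = c * mean f.
Proof.
move=> Pf; rewrite /mean; under eq_integral do rewrite EFinM.
by rewrite integralZl //=; [rewrite !integral_mean|exact: polyfun_integrable..].
Qed.

Let mean_sum (K : finType) (f : K -> 'M[R]_(r, n) -> R) :
  (forall k, polyfun predT (f k)) ->
  mean (fun X => \sum_k f k X) = \sum_k mean (f k).
Proof.
move=> Pf; rewrite /mean; under eq_integral do rewrite -sumEFin.
rewrite integral_sum //=; last by move=> k; exact: polyfun_integrable.
rewrite (eq_bigr (fun k => (mean (f k))%:E)) ?sumEFin // => k _.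
by rewrite integral_mean.
Qed.

Let polyfun_monomial (e : 'I_r * 'I_n -> nat) : polyfun predT
  (fun X : 'M[R]_(r, n) => \prod_(ij : 'I_r * 'I_n) X ij.1 ij.2 ^+ e ij).
Proof.
apply: polyfun_prod => ij _; elim: (e ij) => [|k IHk].
  by under eq_fun do rewrite expr0; exact: polyfun_cst.
by under eq_fun do rewrite exprS; apply: polyfunM => //; exact: polyfun_entry.
Qed.

(** A monomial of [h] and the monomial in row [i] share no entry, so the product
of moments factors, the moment of order 0 being 1. *)
Let mean_row i h (u : 'I_n -> nat) : polyfun (predC1 i) h ->
  mean (fun X => h X * \prod_a X i a ^+ u a) =
  mean h * \prod_a std_moment R (u a).
Proof.
move=> /polyfun_monomials[K [c [e [e0 ->]]]].
(* The exponents [u] of row [i], extended by 0 to the whole matrix. *)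
pose v (ij : 'I_r * 'I_n) := if ij.1 == i then u ij.2 else 0%N.
have prod_row (F : nat -> 'I_r * 'I_n -> R) : (forall ij, F 0%N ij = 1) ->
    \prod_ij F (v ij) ij = \prod_a F (u a) (i, a).
  move=> F0; rewrite (eq_bigr (fun ij => F (v (ij.1, ij.2)) (ij.1, ij.2)));
    last by case.
  rewrite -(pair_bigA _ (fun i a => F (v (i, a)) (i, a))) /=.
  rewrite (bigD1 i) //= /v /= eqxx [X in _ * X]big1 ?mulr1 // => j /negPf ji.
  by rewrite ji big1.
transitivity (mean (fun X => \sum_k c k *
    \prod_(ij : 'I_r * 'I_n) X ij.1 ij.2 ^+ (e k ij + v ij))).
  congr (mean _); apply/funext => Z.
  rewrite -(prod_row (fun m ij => Z ij.1 ij.2 ^+ m)) //.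
  rewrite mulr_suml; apply: eq_bigr => k _; rewrite -mulrA -big_split.
  by congr (_ * _); apply: eq_bigr => ij _; rewrite exprD.
rewrite !mean_sum; try by move=> k; exact: polyfunZ.
rewrite mulr_suml; apply: eq_bigr => k _; rewrite !meanZ //.
rewrite -mulrA /mean !intXE /=; congr (_ * _).
rewrite -(prod_row (fun m _ => std_moment R m)); last first.
  by move=> _; exact: std_moment0.
rewrite -big_split; apply: eq_bigr => -[j a] _ /=; rewrite /v /=.
have [->|ji] := eqVneq j i; last by rewrite addn0 std_moment0 mulr1.
by rewrite e0 ?add0n ?std_moment0 ?mul1r //= eqxx.
Qed.

Let prod_delta (Z : 'M[R]_(r, n)) i a : Z i a = \prod_x Z i x ^+ (x == a).
Proof.
rewrite (bigD1 a) //= eqxx expr1 big1 ?mulr1 // => x /negPf ->.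
by rewrite expr0.
Qed.

(** The mean of a standard normal variable is 0: one entry of degree 1 is enough
for the product to vanish. *)
Let moments_eq0 (u : 'I_n -> nat) a : u a = 1%N ->
  \prod_x std_moment R (u x) = 0.
Proof. by move=> ua; rewrite (bigD1 a) //= ua std_moment1 mul0r. Qed.

Let moments_eq1 (u : 'I_n -> nat) :
  (forall x, std_moment R (u x) = 1) -> \prod_x std_moment R (u x) = 1.
Proof. by move=> u1; rewrite big1. Qed.

Lemma gaussian_functional_mean : gaussian_functional mean.
Proof.
split=> //.
- have -> : mean (fun=> 1) = fine (1%:E * P setT)%E by rewrite /mean integral_cst.
  by rewrite probability_setT mul1e.
- move=> i h a b Ph.
  pose u x := ((x == a) + (x == b))%N.
  transitivity (mean (fun X => h X * \prod_x X i x ^+ u x)).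
    congr (mean _); apply/funext => Z; rewrite (prod_delta _ _ a) (prod_delta _ _ b).
    by rewrite -big_split; congr (_ * _); apply: eq_bigr => x _; rewrite exprD.
  rewrite mean_row // mulrC; congr (_ * _).
  have [ab|ab] := eqVneq a b.
    apply: moments_eq1 => x; rewrite /u -ab.
    by case: (x == a); [exact: std_moment2|exact: std_moment0].
  by apply: (moments_eq0 (a := a)); rewrite /u eqxx (negPf ab).
- move=> i h a b c e Ph.
  (* Degree of each entry of the row. Unless the four indices pair up, some
     entry has degree 1 and both sides vanish; three equal indices leave the
     fourth alone. *)
  pose u x := ((x == a) + (x == b) + ((x == c) + (x == e)))%N.
  transitivity (mean (fun X => h X * \prod_x X i x ^+ u x)).
    congr (mean _); apply/funext => Z; rewrite (prod_delta _ _ a) (prod_delta _ _ b).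
    rewrite (prod_delta _ _ c) (prod_delta _ _ e) -!big_split; congr (_ * _).
    by apply: eq_bigr => x _; rewrite /u /= !exprD.
  rewrite mean_row // mulrC; congr (_ * _).
  have two x y z : y != z ->
      std_moment R ((x == y) + (x == y) + ((x == z) + (x == z))) = 1.
    move=> yz; have [->|xy] := eqVneq x y.
      by rewrite (negPf yz) std_moment2.
    by case: (x == z); [exact: std_moment2|exact: std_moment0].
  have [ab|ab] := eqVneq a b.
    have [ce|ce] := eqVneq c e.
      have [ac|ac] := eqVneq a c.
        rewrite /u -ab -ce -ac (bigD1 a) //= eqxx std_moment4 big1 => [|x /negPf ->].
          by rewrite /=; ring.
        exact: std_moment0.
      rewrite moments_eq1 => [|x]; last by rewrite /u -ab -ce two.
      by rewrite -ce -ab (negPf ac) /=; ring.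
    have [ac|ac] := eqVneq a c.
      rewrite (moments_eq0 (a := e)); last first.
        by rewrite /u -ab ac eqxx [e == c]eq_sym (negPf ce).
      by rewrite -ab ac (negPf ce) /=; ring.
    rewrite (moments_eq0 (a := c)); last first.
      by rewrite /u -ab eqxx (negPf ce) eq_sym (negPf ac).
    by rewrite -ab (negPf ac) /=; ring.
  have [ac|ac] := eqVneq a c.
    have [be|be] := eqVneq b e.
      rewrite moments_eq1 => [|x]; last by rewrite /u -ac -be addnACA two.
      by rewrite -be -ac (negPf ab) /=; ring.
    rewrite (moments_eq0 (a := b)); last first.
      by rewrite /u eqxx -ac (negPf be) eq_sym (negPf ab).
    by rewrite -ac [b == a]eq_sym (negPf ab) /=; ring.
  have [ae|ae] := eqVneq a e.
    have [bc|bc] := eqVneq b c.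
      rewrite moments_eq1 => [|x].
        by rewrite /=; ring.
      by rewrite /u -ae -bc [X in (_ + X)%N]addnC addnACA two.
    rewrite (moments_eq0 (a := b)); last first.
      by rewrite /u eqxx (negPf bc) -ae eq_sym (negPf ab).
    by rewrite /=; ring.
  rewrite (moments_eq0 (a := a)); first by rewrite /=; ring.
  by rewrite /u eqxx (negPf ab) (negPf ac) (negPf ae).
Qed.

End GaussianMatrix.

(** * The Wishart expectation *)

(** Both sides are integrals of [F] against the law of [W], which is also the
law of [X X^T] by hypothesis. *)
Lemma expectation_wishart (R : realType) (r n : nat) d (Omega : measurableType d)
    (P : probability Omega R) (W : {RV P >-> 'M[R]_r})
    d' (Omega' : measurableType d') (P' : probability Omega' R)
    (X : {RV P' >-> 'M[R]_(r, n)}) (F : 'M[R]_r -> R) Q :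
  polyfun Q F ->
  (forall A : set 'M[R]_r, measurable A ->
    distribution P W A = P' [set w | A (X w *m (X w)^T)]%classic) ->
  ('E_P[fun w => F (W w)] = \int[P']_w (F (X w *m (X w)^T))%:E)%E.
Proof.
move=> /polyfun_measurable mF PW; rewrite unlock.
have mG : measurable_fun setT (fun w => X w *m (X w)^T).
  apply: measurable_fun_mx => i j.
  apply: (measurableT_comp _ (f := fun Z : 'M[R]_(r, n) => (Z *m Z^T) i j)).
    by apply: (polyfun_measurable (Q := predT)); exact: polyfun_gram.
  exact: measurable_funP.
have wt d1 (T : measurableType d1) (mu : probability T R) (h : T -> 'M[R]_r) :
    measurable_fun setT h ->
    (forall A, measurable A -> mu (h @^-1` A)%classic = distribution P W A) ->
    (\int[mu]_x (F (h x))%:E = \int[distribution P W]_y (F y)%:E)%E.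
  move=> mh hA.
  rewrite -(@integral_weight _ _ _ _ _ mu (distribution P W) h (fun=> 1)) //.
  - by apply: eq_integral => x _; rewrite mul1r.
  - move=> B mB; rewrite integral_cst ?mul1e; first exact: hA.
    by rewrite -[(_ @^-1` _)%classic]setTI; exact: mh.
rewrite (wt _ _ P W) //.
by rewrite (wt _ _ P' _ mG) // => A mA; rewrite PW.
Qed.

Theorem theorem4p5 (R : realType) (r m n : nat)
    (r_ge1 : (1 <= r)%N) (m_ge1 : (1 <= m)%N) (m_le_r : (m <= r)%N)
    (r_le_n : (r <= n)%N)
    (I J K L : {set 'I_r})
    (cardI : #|I| = m) (cardJ : #|J| = m) (cardK : #|K| = m) (cardL : #|L| = m)
    (symdiffE : symdiff I J = symdiff K L)
    (le : rel 'I_r) (le_total_order : is_total_order le) :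
  let bI := I :\: (I :&: J) in
  let bK := K :\: (K :&: L) in
  let bJ := J :\: (I :&: J) in
  let bL := L :\: (K :&: L) in
  set_lt le ((I :&: J) :\: (K :&: L)) bI ->
  set_lt le bI bJ ->
  set_lt le bJ ((K :&: L) :\: (I :&: J)) ->
  set_lt le (bI :&: bK) (bI :&: bL) ->
  set_lt le (bJ :&: bK) (bJ :&: bL) ->
  forall (d : measure_display) (Omega : measurableType d)
    (P : probability Omega R) (W : {RV P >-> 'M[R]_r}),
  is_wishart n (distribution P W) ->
  'E_P[fun w => (\det (submatrix le cardI cardJ (W w)) *
                 \det (submatrix le cardK cardL (W w)))%R]%E =
  (n`!%:R / (n - m)`!%:R *
   ((n + 2)`!%:R / (n + 2 - #|I :&: J :&: K :&: L|)`!%:R) *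
   ((n - m + #|(I :&: J) :\: (K :&: L)|)`!%:R / (n - m)`!%:R) *
   (#|bI :&: bK|)`!%:R * (#|bI :&: bL|)`!%:R)%:E.
Proof.
move=> bI bK bJ bL ltA ltIJ ltD ltI ltJ d Omega P W.
case=> d1 [T1 [P1 [X [indepX normX lawW]]]].
pose x0 := Ordinal r_ge1.
have Pdet (A B : {set 'I_r}) (cA : #|A| = m) (cB : #|B| = m) :
    polyfun predT (fun Z : 'M[R]_r => \det (submatrix le cA cB Z)).
  by apply: polyfun_det => i j; under eq_fun do rewrite mxE; exact: polyfun_entry.
rewrite (expectation_wishart (polyfunM (Pdet _ _ cardI cardJ)
  (Pdet _ _ cardK cardL)) lawW).
pose f := fun Z : 'M[R]_(r, n) =>
  gram_minor x0 le I J Z * gram_minor x0 le K L Z.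
have Pf : polyfun predT f.
  by apply: polyfunM; apply: polyfun_gram_minorT;
    rewrite ?cardI ?cardJ ?cardK ?cardL.
transitivity (\int[P1]_w (f (X w))%:E)%E.
  by apply: eq_integral => w _; rewrite !(det_submatrix x0).
rewrite integral_mean //; congr (_%:E).
have gE := gaussian_functional_mean indepX normX.
exact: (Ex_product_of_minors x0 le_total_order gE cardI cardJ cardK cardL
  (leq_trans m_le_r r_le_n) symdiffE ltA ltIJ ltD ltI ltJ).
Qed.
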